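(* Let $\{W(t),t\in\mathbb{R}\}$ be one-dimensional standard Brownian motion, $p>0$, $b\in p\mathbb{Z}_{>0}$, $k\in\mathbb{N}$, and let $j_{\min}=-j_{\max}\in\mathbb{Z}_{<0}$ with $b+16<p\,j_{\max}$. Let $\tilde Z_3^{(p)}$, $Z_3^{(k;p)}$, $X_k$, $C_k$ be as defined in the context and let $c(k)<0$ be a real number. Then $$\mathbb{P}\big(Z_3^{(k;p)}(t)\neq\tilde Z_3^{(p)}(t)\text{ for some }t\in[-b,b]\cap p\mathbb{Z}\ \big|\ X_k\leq c(k),\,C_k>c(k)\big)$$ $$\leq\frac{4e^{-c(k)}}p\Bigg(\exp\left(-\sqrt{pj_{\max}-b}\right)+\frac{100}9\sqrt{\frac{b^3}\pi}\exp\left(-\frac{\left(\sqrt{pj_{\max}-b}-\log\left(\sqrt{pj_{\max}-b}\right)\right)^2}{4b}\right)$$ $$+\frac8{\sqrt{2\pi}}\left(1+\frac2{\sqrt{pj_{\max}-b}-4}\right)\exp\left(-\frac{\left(\sqrt{pj_{\max}-b}-4\right)^2}8\right)\Bigg).$$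
   Context: Standard Brownian motion on $\mathbb{R}$ is two-sided with $W(0)=0$ and $\mathrm{Var}(W(t))=|t|$. Let $Y_i^{(j)}$, $i\in\mathbb{N}$, $j\in\mathbb{Z}$, be i.i.d. standard exponential random variables and $X_i^{(j)}:=\log\big(1/\sum_{l=1}^iY_l^{(j)}\big)$; thus $\sum_i\delta_{X_i^{(j)}}$, $j\in\mathbb{Z}$, are independent Poisson point processes on $\mathbb{R}$ with intensity measure $e^{-x}dx$, with points indexed in decreasing order. Let $W_i^{(j)}$, $i\in\mathbb{N}$, $j\in\mathbb{Z}$, be independent copies of $W$, independent of the $Y_i^{(j)}$, and let $T_i^{(j,p)}:=\inf\big(\mathrm{argsup}_{t\in p\mathbb{Z}}(W_i^{(j)}(t)-\frac{|t|}2)\big)$ be the smallest maximizer on the grid $p\mathbb{Z}$. For $t\in p\mathbb{Z}$ define $$\tilde Z_3^{(p)}(t):=\max_{j\in\mathbb{Z}}\ \max_{\substack{i\in\mathbb{N} \\ {} T_i^{(j,p)}\in(-\frac p2,\frac p2]}}\left(X_i^{(j)}+W_i^{(j)}(t-pj)-\tfrac{|t-pj|}2\right),$$ $$Z_3^{(k;p)}(t):=\max_{j=j_{\min},\ldots,j_{\max}}\ \max_{\substack{i=1,\ldots,k \\ {} T_i^{(j,p)}\in(-\frac p2,\frac p2]}}\left(X_i^{(j)}+W_i^{(j)}(t-pj)-\tfrac{|t-pj|}2\right)$$ (the maximum of the empty set being $-\infty$), and $X_k:=\max_{j=j_{\min},\ldots,j_{\max}}X_k^{(j)}$, $C_k:=\inf_{t\in[-b,b]\cap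 p\mathbb{Z}}Z_3^{(k;p)}(t)$. *)

(* Defs.v *)
From HB Require Import structures.
From mathcomp Require Import all_boot all_order all_algebra.
From mathcomp Require Import all_classical all_reals all_analysis.

Set Implicit Arguments.
Unset Strict Implicit.
Unset Printing Implicit Defensive.

Import Order.TTheory GRing.Theory Num.Theory.
Import numFieldNormedType.Exports.

Local Open Scope classical_set_scope.
Local Open Scope ring_scope.

Section probability_notions.
Context d (T : measurableType d) (R : realType) (P : probability T R).

(* Follows the convention x / 0 = 0: the value is 0 when P B = 0. *)
Definition cond_prob (A B : set T) : R := fine (P (A `&` B)) / fine (P B).

(* The sigma-algebra on T generated by the random variables X i with i in D. *)
Definition sigma_gen (I : Type) (D : set I) (X : I -> T -> R) : set_system T :=
  <<s \bigcup_(i in D) preimage_set_system setT (X i) measurable >>.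

(* Mutual independence of the sigma-algebras F i, i in D: the product rule for
   every finite subfamily (enumerated by the duplicate-free sequence s). *)
Definition mutually_independent (I : eqType) (D : set I)
    (F : I -> set_system T) : Prop :=
  forall (s : seq I) (A : I -> set T), uniq s ->
    (forall i, i \in s -> D i /\ F i (A i)) ->
    P (\big[setI/setT]_(i <- s) A i) = (\prod_(i <- s) P (A i))%E.

Definition independent (F G : set_system T) : Prop :=
  forall A B, F A -> G B -> P (A `&` B) = (P A * P B)%E.

Definition standard_exponential (Y : {RV P >-> R}) : Prop :=
  forall A : set R, measurable A -> distribution P Y A = exponential_prob 1 A.

(* Standard two-sided Brownian motion.  The second parameter of [normal_prob]
   is the standard deviation, so W t - W s has variance t - s; together with
   W 0 = 0 this gives Var (W t) = |t| for every real t. *)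
Definition standard_brownian (W : R -> {RV P >-> R}) : Prop :=
  [/\ {ae P, forall w, W 0 w = 0},
      {ae P, forall w, continuous (fun t => W t w)},
      (forall s t : R, s < t -> forall A : set R, measurable A ->
         pushforward P (fun w => W t w - W s w) A
         = normal_prob 0 (Num.sqrt (t - s)) A)
    & (forall (n : nat) (t : nat -> R),
         (forall i, (i < n)%N -> t i < t i.+1) ->
         mutually_independent [set i | (i < n)%N]
           (fun i => sigma_gen [set i]
              (fun l w => W (t l.+1) w - W (t l) w)))].

End probability_notions.

(* The families Y i j and W i j carry indices i : nat, of which only i >= 1
   is ever used or constrained. *)
Section processes.
Context d (T : measurableType d) (R : realType) (P : probability T R).
Variables (Y : nat -> int -> {RV P >-> R}) (W : nat -> int -> R -> {RV P >-> R}).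

Definition pos_index : set (nat * int) := [set ij | (1 <= ij.1)%N].

Definition iid_standard_exponentials : Prop :=
  (forall i j, (1 <= i)%N -> standard_exponential (Y i j)) /\
  mutually_independent P pos_index
    (fun ij => sigma_gen [set ij] (fun kl => Y kl.1 kl.2)).

Definition independent_brownians : Prop :=
  (forall i j, (1 <= i)%N -> standard_brownian (W i j)) /\
  mutually_independent P pos_index
    (fun ij => sigma_gen setT (fun t => W ij.1 ij.2 t)).

Definition brownians_independent_of_exponentials : Prop :=
  independent P
    (sigma_gen [set ijt | pos_index ijt.1]
       (fun ijt : nat * int * R => W ijt.1.1 ijt.1.2 ijt.2))
    (sigma_gen pos_index (fun ij => Y ij.1 ij.2)).

Definition grid (p : R) : set R := [set m%:~R * p | m in [set: int]].

Definition Xpoint (i : nat) (j : int) (w : T) : R :=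
  ln (1 / \sum_(1 <= l < i.+1) Y l j w).

Definition drifted (i : nat) (j : int) (t : R) (w : T) : R :=
  W i j t w - `|t| / 2.

Definition argsup_grid (p : R) (i : nat) (j : int) (w : T) : set R :=
  [set t | grid p t /\
     forall s, grid p s -> drifted i j s w <= drifted i j t w].

(* Extended-real infimum: it is +oo if there is no maximizer (a null event),
   so that such a point never satisfies the window condition below. *)
Definition Tmax (p : R) (i : nat) (j : int) (w : T) : \bar R :=
  ereal_inf (EFin @` argsup_grid p i j w).

Definition in_window (p : R) (i : nat) (j : int) (w : T) : Prop :=
  ((- (p / 2))%:E < Tmax p i j w)%E /\ (Tmax p i j w <= (p / 2)%:E)%E.

(* The maximum over j in J and i in I with T_i^(j,p) in (-p/2, p/2], as a
   supremum in the extended reals; the supremum of the empty set is -oo. *)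
Definition Zmax (p : R) (J : set int) (I : set nat) (t : R) (w : T) : \bar R :=
  ereal_sup [set ereal_sup
      [set (Xpoint i j w + drifted i j (t - p * j%:~R) w)%:E |
         i in [set i | I i /\ in_window p i j w]] | j in J].

Definition Z3tilde (p : R) : R -> T -> \bar R :=
  Zmax p [set: int] [set i | (1 <= i)%N].

Definition Z3 (jmin jmax : int) (k : nat) (p : R) : R -> T -> \bar R :=
  Zmax p [set j | jmin <= j <= jmax] [set i | (1 <= i <= k)%N].

Definition Xk (jmin jmax : int) (k : nat) (w : T) : \bar R :=
  ereal_sup [set (Xpoint k j w)%:E | j in [set j | jmin <= j <= jmax]].

Definition Ck (jmin jmax : int) (b : R) (k : nat) (p : R) (w : T) : \bar R :=
  ereal_inf [set Z3 jmin jmax k p t w | t in `[- b, b] `&` grid p].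

End processes.

(* Main.v *)
Require Import Defs.
From HB Require Import structures.
From mathcomp Require Import all_boot all_order all_algebra.
From mathcomp Require Import all_classical all_reals all_analysis.
From mathcomp Require Import measurable_realfun ring lra zify.

(** A path enters the maxima only if its smallest grid maximizer lies in
(-p/2, p/2], and 0 is the only grid point there.  As W(0) = 0 almost surely,
such a path satisfies W(s) - |s|/2 <= 0 at every grid time s ([in_windowP]).
On the event X_k <= c < C_k, a point of index i > k on a level |j| <= j_max
therefore contributes at most X_i <= X_k <= c < Z_3(t) and cannot change the
maximum at t.  Hence, if the two maxima differ, some point on a level
|j| > j_max has a contribution larger than c at a grid time of [-b, b]
([differ_sub_far]).

The conditioning event depends on the levels |j| <= j_max only, the event just
described is covered by one that depends on the other levels only, and these
are independent ([levels_independent]).  It remains to bound the unconditional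
probability of the covering event ([far_event_prob]).

Write G_i = Y_1 + ... + Y_i, so that X_i = - log G_i, and let S be the maximum,
over the grid times s at which the path is observed, of
exp((W(s) - |s|/2) / 2).  A contribution larger than c of a path in the window
means S <= 1 and G_i < S^2 e^(-c).  Sorting by the dyadic size of S, one has
G_i < 4^(-n) e^(-c) and S > 2^(-n-1) for some n; these two events are
independent.  Chernoff's bound controls the first ([exponential_sum_tail]):
summed over i, its probability is at most e times 4^(-n) e^(-c).  For the
second, exp((W(s) - |s|/2) / 2) is a nonnegative supermartingale along the grid
with mean e^(-|s|/8), so that P(S > u) <= e^(-x/8) / u, where x is the distance
from the observed times to 0 ([bm_exp_maximal]).  Every sum (over i, over n and
over the levels) is geometric.  With r^2 = p j_max - b the total is
(4 e^(-c) / p) 16 e e^(-r^2/8), which is at most the contribution of the third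
term of the claimed bound ([far_bound_le_third_term]). *)

Set Implicit Arguments.
Unset Strict Implicit.
Unset Printing Implicit Defensive.

Import Order.TTheory GRing.Theory Num.Theory.
Import numFieldNormedType.Exports.

Local Open Scope classical_set_scope.
Local Open Scope ring_scope.

(** * Geometric union bounds and the pi-lambda argument *)

Lemma measure_bigcup_geometric d (T : measurableType d) (R : realType)
    (mu : {measure set T -> \bar R}) (F : nat -> set T) (C q : R) :
  (forall n, measurable (F n)) -> 0 <= C -> 0 <= q -> q < 1 ->
  (forall n, (mu (F n) <= (C * q ^+ n)%:E)%E) ->
  (mu (\bigcup_n F n) <= (C / (1 - q))%:E)%E.
Proof.
move=> mF C0 q0 q1 FC.
apply: le_trans.
  by apply: (@measure_sigma_subadditive _ _ _ mu _ _ mF (bigcupT_measurable F mF)).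
apply: (@le_trans _ _ (\sum_(n <oo) (C * q ^+ n)%:E)%E).
  exact: lee_nneseries.
have cvgq : series (geometric C q) @ \oo --> C * (1 - q)^-1.
  by apply: cvg_geometric_series; rewrite ger0_norm.
rewrite -(cvg_lim _ cvgq)// -EFin_lim; last by apply/cvg_ex; eexists; exact: cvgq.
rewrite le_eqVlt; apply/orP; left; apply/eqP; congr (limn _).
by apply/funext => n /=; rewrite /series /geometric /= sumEFin.
Qed.

(** For fixed [B], the sets [A] with P(A B) = P(A) P(B) form a Dynkin system;
applying this in each argument in turn extends independence from pi-systems to
the sigma-algebras they generate. *)
Section dynkin_independence.
Context d (T : measurableType d) (R : realType) (P : probability T R).

Let indep_dynkin (B : set T) : measurable B ->
  dynkin [set A | measurable A /\ P (A `&` B) = (P A * P B)%E].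
Proof.
move=> mB; split.
- by split => //; rewrite setTI probability_setT mul1e.
- move=> A [mA AB]; split; first exact: measurableC.
  have -> : ~` A `&` B = B `\` A by rewrite setDE setIC.
  have -> : P (B `\` A) = (P B - P (A `&` B))%E.
    by rewrite setIC; apply: measureD => //; rewrite ltey_eq fin_num_measure.
  by rewrite AB probability_setC// muleBl ?mul1e ?fin_num_measure.
- move=> F tF FB; have mF n : measurable (F n) by case: (FB n).
  split; first exact: bigcupT_measurable.
  rewrite setI_bigcupl measure_bigcup//; last 2 first.
  + by move=> k _; exact: measurableI.
  + by apply: trivIset_setIr; exact: tF.
  rewrite measure_bigcup//.
  rewrite -[P B]fineK ?fin_num_measure// muleC -nneseriesZl//.
  apply: eq_eseriesr => n _; rewrite fineK ?fin_num_measure// muleC.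
  by case: (FB n).
Qed.

Lemma independent_gen (G H : set_system T) :
  G `<=` measurable -> H `<=` measurable -> setI_closed G -> setI_closed H ->
  independent P G H -> independent P <<s G >> <<s H >>.
Proof.
move=> mG mH GI HI GH.
have sub (K L : set_system T) : K `<=` measurable -> L `<=` measurable ->
    setI_closed K -> independent P K L -> independent P <<s K >> L.
  move=> mK mL KI KL A B sA LB.
  suff : <<d K >> `<=` [set A | measurable A /\ P (A `&` B) = (P A * P B)%E].
    by rewrite setI_closed_g_dynkin_g_sigma_algebra// => /(_ A sA)[].
  apply: smallest_sub; first exact/indep_dynkin/mL.
  by move=> X KX; split; [exact: mK|exact: KL].
have sym (K L : set_system T) : independent P K L -> independent P L K.
  by move=> KL A B LA KB; rewrite setIC muleC; exact: KL.
have msG : <<s G >> `<=` measurable.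
  by apply: smallest_sub => //; exact: sigma_algebra_measurable.
by apply/sym/sub => //; apply/sym; exact: sub.
Qed.

End dynkin_independence.

(** * Independence of blocks of coordinates *)

Lemma big_setIP (T : Type) (I : eqType) (s : seq I) (A : I -> set T) w :
  (\big[setI/setT]_(i <- s) A i) w <-> (forall i, i \in s -> A i w).
Proof.
elim: s => [|i s IH]; first by rewrite big_nil.
rewrite big_cons; split=> [[Aiw /IH sw] j|H].
  by rewrite in_cons => /orP[/eqP ->//|/sw].
split; first by apply: H; rewrite mem_head.
by apply/IH => j js; apply: H; rewrite in_cons js orbT.
Qed.

(** The pi-system that generates the joint sigma-algebra of the [F i], [i] in
[D]: finite intersections of sets with distinct indices. *)
Definition cap_system (T : Type) (I : eqType) (D : set I)
    (F : I -> set_system T) : set_system T :=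
  [set B | exists s : seq I, exists A : I -> set T, [/\ uniq s,
     (forall i, i \in s -> D i /\ F i (A i)) &
     B = \big[setI/setT]_(i <- s) A i]].


Lemma sigma_algebraTI (T : Type) (G : set_system T) :
  sigma_algebra setT G -> G setT /\ setI_closed G.
Proof. by move=> /(sigma_algebraP (fun X _ => @subsetT _ X))[]. Qed.

Section blocks.
Context d (T : measurableType d) (R : realType) (P : probability T R).

(** Two index lists are merged by intersecting the sets attached to a common
index and attaching the whole space to an index missing from one of them. *)
Lemma cap_system_setI (I : eqType) (D : set I) (F : I -> set_system T) :
  (forall i, D i -> sigma_algebra setT (F i)) -> setI_closed (cap_system D F).
Proof.
move=> sF _ _ [s1 [A1 [u1 FA1 ->]]] [s2 [A2 [u2 FA2 ->]]].
exists (undup (s1 ++ s2)), (fun i => (if i \in s1 then A1 i else setT) `&`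
  (if i \in s2 then A2 i else setT)); split.
- exact: undup_uniq.
- move=> i; rewrite mem_undup mem_cat => is12.
  have Di : D i by case/orP: is12 => [/FA1[]|/FA2[]].
  split=> //; have [FT FI] := sigma_algebraTI (sF _ Di).
  by apply: FI; case: ifPn => //; [move=> /FA1[]|move=> /FA2[]].
- apply/seteqP; split=> w.
    move=> [/big_setIP h1 /big_setIP h2]; apply/big_setIP => i _.
    by split; case: ifPn => //; [move=> /h1|move=> /h2].
  move/big_setIP => h; split; apply/big_setIP => i si.
    have [|+ _] := h i; first by rewrite mem_undup mem_cat si.
    by rewrite si.
  have [|_] := h i; first by rewrite mem_undup mem_cat si orbT.
  by rewrite si.
Qed.

(** The product rule over the concatenation of two index lists splits into the
two blocks, which settles the pi-systems of finite intersections. *)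
Lemma independent_blocks (I : eqType) (D D1 D2 : set I)
    (F : I -> set_system T) :
  (forall i, D i -> sigma_algebra setT (F i)) ->
  (forall i, D i -> F i `<=` measurable) ->
  mutually_independent P D F ->
  D1 `<=` D -> D2 `<=` D -> D1 `&` D2 = set0 ->
  independent P <<s \bigcup_(i in D1) F i >> <<s \bigcup_(i in D2) F i >>.
Proof.
move=> sF mF FI D1D D2D D120.
have cap_sub (E : set I) : E `<=` D ->
    <<s \bigcup_(i in E) F i >> `<=` <<s cap_system E F >>.
  move=> ED; apply: smallest_sub; first exact: smallest_sigma_algebra.
  move=> A [i Ei FA]; apply: sub_sigma_algebra.
  exists [:: i], (fun=> A); split=> //; last by rewrite big_seq1.
  by move=> j; rewrite inE => /eqP ->.
have capm (E : set I) : E `<=` D -> cap_system E F `<=` measurable.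
  move=> ED A [s [B [_ FB ->]]]; rewrite big_seq.
  apply: bigsetI_measurable => i /FB[Ei]; apply: mF; exact: ED.
have capI (E : set I) : E `<=` D -> setI_closed (cap_system E F).
  by move=> ED; apply: cap_system_setI => i /ED; exact: sF.
move=> A B /(cap_sub _ D1D) sA /(cap_sub _ D2D) sB.
move: A B sA sB; apply: independent_gen; [exact: capm|exact: capm|exact: capI|
  exact: capI|].
move=> _ _ [s1 [A1 [u1 FA1 ->]]] [s2 [A2 [u2 FA2 ->]]].
have ndis i : i \in s2 -> i \notin s1.
  move=> i2; apply/negP => i1; have : (D1 `&` D2) i.
    by split; [case: (FA1 _ i1)|case: (FA2 _ i2)].
  by rewrite D120.
pose A i := if i \in s1 then A1 i else A2 i.
have AE1 : \big[setI/setT]_(i <- s1) A1 i = \big[setI/setT]_(i <- s1) A i.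
  by apply: eq_big_seq => i i1; rewrite /A i1.
have AE2 : \big[setI/setT]_(i <- s2) A2 i = \big[setI/setT]_(i <- s2) A i.
  by apply: eq_big_seq => i /ndis/negbTE i1; rewrite /A i1.
have FA_1 i : i \in s1 -> D i /\ F i (A i).
  by move=> i1; rewrite /A i1; case: (FA1 _ i1) => /D1D.
have FA_2 i : i \in s2 -> D i /\ F i (A i).
  move=> i2; rewrite /A (negbTE (ndis _ i2)); case: (FA2 _ i2) => /D2D//.
rewrite AE1 AE2 -big_cat/= (FI _ _ u1)// (FI _ _ u2)// (FI (s1 ++ s2)).
- by rewrite big_cat.
- rewrite cat_uniq u1 u2 andbT; apply/hasPn => i; exact: ndis.
- by move=> i; rewrite mem_cat => /orP[/FA_1|/FA_2].
Qed.

(** An index list in the sum type is a permutation of a left part followed by a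
right part, and the two parts are separated by independence of [G1] and [G2]. *)
Lemma mutually_independent_sum (I1 I2 : eqType) (D1 : set I1) (D2 : set I2)
    (F1 : I1 -> set_system T) (F2 : I2 -> set_system T)
    (G1 G2 : set_system T) :
  sigma_algebra setT G1 -> sigma_algebra setT G2 -> independent P G1 G2 ->
  (forall i, D1 i -> F1 i `<=` G1) -> (forall i, D2 i -> F2 i `<=` G2) ->
  mutually_independent P D1 F1 -> mutually_independent P D2 F2 ->
  mutually_independent P
    [set i : I1 + I2 | match i with inl i => D1 i | inr i => D2 i end]
    (fun i => match i with inl i => F1 i | inr i => F2 i end).
Proof.
move=> sG1 sG2 G12 FG1 FG2 FI1 FI2 s A us FA.
have [GT1 GI1] := sigma_algebraTI sG1; have [GT2 GI2] := sigma_algebraTI sG2.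
pose s1 := pmap (fun i : I1 + I2 => if i is inl i then Some i else None) s.
pose s2 := pmap (fun i : I1 + I2 => if i is inr i then Some i else None) s.
have mem1 i : (i \in s1) = (inl i \in s).
  rewrite mem_pmap; apply/mapP/idP => [[[j|j] js //= [->]]//|i1].
  by exists (inl i).
have mem2 i : (i \in s2) = (inr i \in s).
  rewrite mem_pmap; apply/mapP/idP => [[[j|j] js //= [->]]//|i1].
  by exists (inr i).
have u1 : uniq s1.
  by apply: (@pmap_uniq _ _ _ inl) us => -[].
have u2 : uniq s2.
  by apply: (@pmap_uniq _ _ _ inr) us => -[].
have sE : perm_eq s (map inl s1 ++ map inr s2).
  apply: uniq_perm => //.
    rewrite cat_uniq !map_inj_uniq ?u1 ?u2; last 2 first.
    - by move=> ? ? [].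
    - by move=> ? ? [].
    by rewrite andbT/=; apply/hasPn => _ /mapP[i _ ->]; apply/negP => /mapP[].
  move=> [i|i]; rewrite mem_cat.
    rewrite mem_map ?mem1; last by move=> ? ? [].
    by rewrite orbC; case: mapP => // -[].
  rewrite [X in _ || X]mem_map ?mem2; last by move=> ? ? [].
  by case: mapP => // -[].
have FA1 i : i \in s1 -> D1 i /\ F1 i (A (inl i)) by rewrite mem1 => /FA.
have FA2 i : i \in s2 -> D2 i /\ F2 i (A (inr i)) by rewrite mem2 => /FA.
rewrite !(perm_big _ sE)/= !big_cat/= !big_map.
rewrite -(FI1 _ _ u1 FA1) -(FI2 _ _ u2 FA2); apply: G12.
  rewrite big_seq; apply: big_ind => [|X Y|i /FA1[D1i]]; [exact: GT1|exact: GI1|exact: FG1].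
rewrite big_seq; apply: big_ind => [|X Y|i /FA2[D2i]]; [exact: GT2|exact: GI2|exact: FG2].
Qed.

(** By uniqueness of product measures the joint law of [U] and [V] is the
product of their laws, so Tonelli's theorem factors the integral. *)
Lemma independent_integralM (U V : T -> R) :
  measurable_fun setT U -> measurable_fun setT V ->
  (forall w, 0 <= U w) -> (forall w, 0 <= V w) ->
  (forall A B, measurable A -> measurable B ->
    P (U @^-1` A `&` V @^-1` B) = (P (U @^-1` A) * P (V @^-1` B))%E) ->
  (\int[P]_w (U w * V w)%:E = \int[P]_w (U w)%:E * \int[P]_w (V w)%:E)%E.
Proof.
move=> mU mV U0 V0 UV.
pose U' : {RV P >-> R} := mfun_Sub (mem_set mU).
pose V' : {RV P >-> R} := mfun_Sub (mem_set mV).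
have mUV : measurable_fun setT (fun w => (U w, V w)).
  exact/measurable_fun_pairP.
pose UV' : {mfun T >-> (R * R)%type} := mfun_Sub (mem_set mUV).
pose m1 := distribution P U'.
pose m2 := distribution P V'.
(* absolute values make the integrand nonnegative on the whole plane *)
pose f (z : R * R) : \bar R := (`|z.1| * `|z.2|)%:E.
have mf : measurable_fun [set: (R * R)%type] f.
  apply/measurable_EFinP; apply: measurable_funM; apply: measurableT_comp => //.
have f0 z : (0 <= f z)%E by rewrite lee_fin mulr_ge0.
have mn : measurable_fun [set: R] (fun x : R => `|x|%:E).
  by apply/measurable_EFinP; exact: normr_measurable.
transitivity (\int[distribution P UV']_z f z)%E.
  rewrite ge0_integral_distribution//; apply: eq_integral => w _ /=.
  by rewrite /f/= !ger0_norm.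
transitivity (\int[m1 \x m2]_z f z)%E.
  apply: eq_measure_integral => A mA _; apply/esym.
  exact: (product_measure_unique (m1 := m1) (m2 := m2)
    (m' := distribution P UV')).
rewrite fubini_tonelli1//.
transitivity (\int[m1]_x (`|x|%:E * \int[m2]_y `|y|%:E))%E.
  apply: eq_integral => x _; rewrite /fubini_F -ge0_integralZl ?lee_fin//.
rewrite ge0_integralZr//; last exact: integral_ge0.
rewrite /m1 /m2 !ge0_integral_distribution//.
by congr (_ * _)%E; apply: eq_integral => w _ /=; rewrite ger0_norm.
Qed.

End blocks.

(** * Integrals against a law with a density *)

Section density.
Import HBNNSimple.

(** Simple functions reduce to indicators, where this is the hypothesis on
[nu]; both sides are continuous along increasing approximations. *)
Lemma ge0_integral_density d (T : measurableType d) (R : realType)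
    (nu mu : {measure set T -> \bar R}) (g : T -> R) (f : T -> \bar R) :
  measurable_fun setT g -> (forall x, 0 <= g x) ->
  (forall A, measurable A -> nu A = \int[mu]_(x in A) (g x)%:E)%E ->
  measurable_fun setT f -> (forall x, 0 <= f x)%E ->
  (\int[nu]_x f x = \int[mu]_x (f x * (g x)%:E))%E.
Proof.
move=> mg g0 nuE mf f0.
have mgE D : measurable_fun D (EFin \o g).
  by apply/measurable_EFinP; exact: measurable_funTS.
pose h := nnsfun_approx measurableT mf.
have mh n : measurable_fun setT (EFin \o h n).
  exact/measurable_EFinP/measurable_funP.
have fE x : f x = lim ((EFin \o h n) x @[n --> \oo]).
  by apply/esym/cvg_lim => //; exact: cvg_nnsfun_approx.
have -> : (\int[nu]_x f x = lim (\int[nu]_x (EFin \o h n) x @[n --> \oo]))%E.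
  under eq_integral do rewrite fE.
  apply: monotone_convergence => //.
  - by move=> n x _ /=; rewrite lee_fin.
  - by move=> x _ a b ab; rewrite lee_fin; exact/lefP/nd_nnsfun_approx.
have -> : (\int[mu]_x (f x * (g x)%:E) =
    lim (\int[mu]_x ((EFin \o h n) x * (g x)%:E) @[n --> \oo]))%E.
  have fg x : (f x * (g x)%:E =
      lim (((EFin \o h n) x * (g x)%:E) @[n --> \oo]))%E.
    apply/esym/cvg_lim => //; apply: cvgeZr => //.
    exact: cvg_nnsfun_approx.
  under eq_integral do rewrite fg.
  apply: monotone_convergence => //.
  - by move=> n; exact: emeasurable_funM.
  - by move=> n x _ /=; rewrite mule_ge0 ?lee_fin.
  - move=> x _ a b ab/=; rewrite lee_wpmul2r ?lee_fin//.
    exact/lefP/nd_nnsfun_approx.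
suff suf n : (\int[mu]_x ((EFin \o h n) x * (g x)%:E) =
    \int[nu]_x (EFin \o h n) x)%E.
  by under eq_fun do rewrite -suf.
transitivity (\int[nu]_x
   (\sum_(y \in range (h n)) (y * \1_(h n @^-1` [set y]) x)%:E))%E; last first.
  by apply: eq_integral => t tE; rewrite /= fimfunE -fsumEFin.
have indich m r : measurable_fun setT (fun x => (r * \1_(h m @^-1` [set r]) x)%:E).
  by apply: (measurable_comp measurableT) => //; exact: measurable_funM.
rewrite ge0_integral_fsum//; last by move=> m y Ey; exact: nnfun_muleindic_ge0.
transitivity (\int[mu]_x (\sum_(y \in range (h n))
    (y * \1_(h n @^-1` [set y]) x)%:E * (g x)%:E))%E.
  under [RHS]eq_integral => x xE.
    rewrite -ge0_mule_fsuml => [|y]; last exact: nnfun_muleindic_ge0.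
    rewrite fsumEFin // -(fimfunE _ x); over.
  by [].
rewrite ge0_integral_fsum//; last 2 first.
  - by move=> y; apply: emeasurable_funM.
  - by move=> m y Ey; apply: mule_ge0; [exact: nnfun_muleindic_ge0|rewrite lee_fin].
apply: eq_fsbigr => r rhn.
under [RHS]eq_integral do rewrite EFinM.
rewrite integralZl_indic_nnsfun => //.
under eq_integral do rewrite EFinM -muleA.
rewrite ge0_integralZl//.
- under eq_integral do rewrite muleC.
  rewrite (eq_integral ((EFin \o g) \_ (h n @^-1` [set r]))); last first.
    by move=> x xE; rewrite epatch_indic.
  by rewrite -integral_mkcond -nuE// integral_indic// setIT.
- by apply: emeasurable_funM => //; exact/measurable_EFinP.
- by move=> t Et; rewrite mule_ge0 ?lee_fin.
- by move: rhn; rewrite inE => -[t _ <-]; rewrite lee_fin.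
Qed.

End density.

Lemma ge0_integral_law d d' (T : measurableType d) (T' : measurableType d')
    (R : realType) (P : probability T R) (mu : {measure set T' -> \bar R})
    (X : T -> T') (g f : T' -> R) :
  measurable_fun setT X -> measurable_fun setT g -> (forall x, 0 <= g x) ->
  (forall A, measurable A -> P (X @^-1` A) = \int[mu]_(x in A) (g x)%:E)%E ->
  measurable_fun setT f -> (forall x, 0 <= f x) ->
  (\int[P]_w (f (X w))%:E = \int[mu]_x (f x * g x)%:E)%E.
Proof.
move=> mX mg g0 XE mf f0.
pose X' : {mfun T >-> T'} := mfun_Sub (mem_set mX).
have mfE : measurable_fun setT (EFin \o f) by exact/measurable_EFinP.
transitivity (\int[distribution P X']_x (f x)%:E)%E.
  by rewrite ge0_integral_distribution//= => x; rewrite lee_fin.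
rewrite (ge0_integral_density (nu := distribution P X') mg g0 XE mfE)//.
Qed.

Section laws.
Context d (T : measurableType d) (R : realType) (P : probability T R).

(** Completing the square turns [expR (a * x)] times the centred density into a
constant times the density shifted by [a * s ^+ 2]. *)
Lemma normal_mgf (X : T -> R) (s a : R) :
  measurable_fun setT X -> 0 < s ->
  (forall A, measurable A -> P (X @^-1` A) = normal_prob 0 s A) ->
  (\int[P]_w (expR (a * X w))%:E = (expR (a ^+ 2 * s ^+ 2 / 2))%:E)%E.
Proof.
move=> mX s0 XE.
have mexp : measurable_fun setT (fun x : measurableTypeR R => expR (a * x)).
  by apply: measurableT_comp => //; exact: measurable_funM.
rewrite (ge0_integral_law (T' := measurableTypeR R)
  (mu := lebesgue_measure) (f := fun x => expR (a * x)) mX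
  (measurable_normal_pdf 0 s) (normal_pdf_ge0 0 s) XE mexp (fun=> expR_ge0 _)).
have E x : (expR (a * x) * normal_pdf 0 s x)%:E =
    ((expR (a ^+ 2 * s ^+ 2 / 2))%:E * (normal_pdf (a * s ^+ 2) s x)%:E)%E.
  rewrite -EFinM; congr EFin; rewrite !normal_pdfE ?gt_eqF// /normal_fun.
  rewrite mulrCA [RHS]mulrCA; congr (_ * _); rewrite -!expRD; congr expR.
  by field; rewrite gt_eqF.
under eq_integral do rewrite E.
rewrite ge0_integralZl//.
- by rewrite integral_normal_pdf mule1.
- by apply/measurable_EFinP; exact: measurable_normal_pdf.
- by move=> x _; rewrite lee_fin normal_pdf_ge0.
Qed.

(** [expR (- c * x)] times the density of rate 1 is a multiple of the density
of rate [1 + c]. *)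
Lemma exponential_laplace (X : T -> R) (c : R) :
  measurable_fun setT X -> 0 <= c ->
  (forall A, measurable A -> P (X @^-1` A) = exponential_prob 1 A) ->
  (\int[P]_w (expR (- c * X w))%:E = ((1 + c)^-1)%:E)%E.
Proof.
move=> mX c0 XE.
have mexp : measurable_fun setT (fun x : measurableTypeR R => expR (- c * x)).
  by apply: measurableT_comp => //; exact: measurable_funM.
rewrite (ge0_integral_law (T' := measurableTypeR R)
  (mu := lebesgue_measure) (f := fun x => expR (- c * x)) mX
  (measurable_exponential_pdf 1) (exponential_pdf_ge0 ler01) XE mexp (fun=> expR_ge0 _)).
have c1 : 0 < 1 + c by lra.
have E x : (expR (- c * x) * exponential_pdf 1 x)%:E =
    (((1 + c)^-1)%:E * (exponential_pdf (1 + c) x)%:E)%E.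
  rewrite -EFinM; congr EFin; have [x0|x0] := ltP x 0.
    by rewrite !lt0_exponential_pdf// !mulr0.
  rewrite !exponential_pdfE// mulKf ?gt_eqF// mul1r -expRD; congr expR; ring.
under eq_integral do rewrite E.
rewrite ge0_integralZl//.
- by rewrite integral_exponential_pdf// mule1.
- by apply/measurable_EFinP; exact: measurable_exponential_pdf.
- by move=> x _; rewrite lee_fin exponential_pdf_ge0// ltW.
- by rewrite lee_fin invr_ge0 ltW.
Qed.

End laws.

(** * Markov's inequality and the maximal inequality *)

Section expectations.
Context d (T : measurableType d) (R : realType) (P : probability T R).

Lemma markov_ge1 (A : set T) (f : T -> R) :
  measurable A -> measurable_fun setT f -> (forall w, 0 <= f w) ->
  (forall w, A w -> 1 <= f w) -> (P A <= \int[P]_w (f w)%:E)%E.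
Proof.
move=> mA mf f0 f1.
rewrite -(setIT A) -integral_indic//; apply: ge0_le_integral => //.
- by apply/measurable_EFinP.
- by apply/measurable_EFinP.
- move=> w _; rewrite lee_fin indicE; case: (boolP (w \in A)) => [|//].
  by rewrite inE => /f1.
Qed.

(** Stop [N] when it first exceeds [u]: the mean of the stopped process does not
increase, and stopped paths count for at least [u]. *)
Lemma supermartingale_maximal (G : nat -> set_system T) (N : nat -> T -> R) (u : R) :
  (forall n, sigma_algebra setT (G n)) -> (forall n, G n `<=` measurable) ->
  (forall n, G n `<=` G n.+1) ->
  (forall n, G n [set w | u < N n w]) ->
  (forall n, measurable_fun setT (N n)) -> (forall n w, 0 <= N n w) ->
  (forall n A, G n A ->
    \int[P]_(w in A) (N n.+1 w)%:E <= \int[P]_(w in A) (N n w)%:E)%E ->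
  0 <= u -> forall n,
  (u%:E * P [set w | exists2 m, (m <= n)%N & (u < N m w)%R]
   <= \int[P]_w (N 0%N w)%:E)%E.
Proof.
move=> sG mG GS GN mN N0 super u0 n.
pose E n := [set w | exists2 m, (m <= n)%N & u < N m w].
have ES k : E k.+1 = E k `|` [set w | u < N k.+1 w].
  apply/seteqP; split=> w.
    move=> [m]; rewrite leq_eqVlt ltnS => /orP[/eqP ->|mk] um; first by right.
    by left; exists m.
  move=> [[m mk um]|uk]; first by exists m => //; exact: leqW.
  by exists k.+1.
have GC k A : G k A -> G k (~` A).
  by move=> GA; have [_ + _] := sG k; rewrite -setTD; exact.
have GI k : setI_closed (G k) := (sigma_algebraTI (sG k)).2.
have GE k : G k (E k).
  elim: k => [|k IH].
    rewrite (_ : E 0%N = [set w | u < N 0%N w])//.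
    apply/seteqP; split=> w; first by move=> [m]; rewrite leqn0 => /eqP ->.
    by exists 0%N.
  rewrite ES -(setCK (_ `|` _)) setCU; apply: (GC); apply: (GI); apply: (GC) => //.
  exact: GS.
have mE k : measurable (E k) by exact/mG/GE.
have mNu k : measurable [set w | u < N k w] by exact/mG/GN.
have mNE k A : measurable_fun A (EFin \o N k).
  by apply/measurable_EFinP; exact: measurable_funTS.
have le_split k A : measurable A -> (u%:E * P (A `&` [set w | (u < N k w)%R]) +
    \int[P]_(w in A `\` [set w | (u < N k w)%R]) (N k w)%:E
      <= \int[P]_(w in A) (N k w)%:E)%E.
  move=> mA; rewrite -[X in (_ <= \int[P]_(w in X) _)%E](setUIDK A [set w | u < N k w]).
  rewrite ge0_integral_setU//; last 5 first.
  - exact: measurableI.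
  - exact: measurableD.
  - exact: mNE.
  - by move=> w _; rewrite lee_fin.
  - by apply/disj_setPS => w [[_ ?] []].
  apply: leeD => //; rewrite -integral_cst; last exact: measurableI.
  apply: ge0_le_integral => //; first exact: measurableI.
  - exact: mNE.
  - by move=> w [_ /=]; rewrite lee_fin => /ltW.
have main k : (u%:E * P (E k) + \int[P]_(w in ~` E k) (N k w)%:E
    <= \int[P]_w (N 0%N w)%:E)%E.
  elim: k => [|k IH].
    have := le_split 0%N setT measurableT.
    have -> : setT `&` [set w | u < N 0%N w] = E 0%N.
      rewrite setTI; apply/seteqP; split=> w; first by exists 0%N.
      by move=> [m]; rewrite leqn0 => /eqP ->.
    have -> // : setT `\` [set w | u < N 0%N w] = ~` E 0%N.
    rewrite setTD; congr (~` _).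
    apply/seteqP; split=> w; first by exists 0%N.
    by move=> [m]; rewrite leqn0 => /eqP ->.
  apply: le_trans IH; apply: (@le_trans _ _ (u%:E * P (E k) +
     \int[P]_(w in ~` E k) (N k.+1 w)%:E)%E); last first.
    by apply: leeD => //; apply/super/GC/GE.
  have -> : E k.+1 = E k `|` (~` E k `&` [set w | u < N k.+1 w]).
    by rewrite ES setUIr setUCr setTI.
  rewrite setCU setCI setCK setIUr setICl set0U -setDE.
  rewrite measureU//; last 2 first.
  - by apply: measurableI => //; exact: measurableC.
  - by rewrite setIA setICr set0I.
  rewrite ge0_muleDr// -addeA; apply: leeD => //; apply: le_split.
  exact: measurableC.
apply: le_trans (main n); rewrite leeDl//.
by apply: integral_ge0 => w _; rewrite lee_fin.
Qed.

End expectations.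

(** * Measurability with respect to generated sigma-algebras, and sums of exponentials *)

Lemma measurable_sum_seq d (T : measurableType d) (R : realType) (I : eqType)
    (s : seq I) (D : set T) (h : I -> T -> R) :
  (forall i, i \in s -> measurable_fun D (h i)) ->
  measurable_fun D (fun x => \sum_(i <- s) h i x).
Proof.
elim: s => [|i s IH] mh.
  by rewrite (_ : (fun x => _) = cst 0)//; apply/funext => x; rewrite big_nil.
rewrite (_ : (fun x => _) = (fun x => h i x + \sum_(j <- s) h j x)); last first.
  by apply/funext => x; rewrite big_cons.
apply: measurable_funD; first by apply: mh; rewrite mem_head.
by apply: IH => j js; apply: mh; rewrite in_cons js orbT.
Qed.

Lemma measurable_le_set d (T : measurableType d) (R : realType) (f g : T -> R) :
  measurable_fun setT f -> measurable_fun setT g ->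
  measurable [set w | f w <= g w].
Proof.
move=> mf mg; rewrite -[X in measurable X]setTI.
exact: (measurable_fun_ler mf mg measurableT (Y := [set true])).
Qed.

Lemma measurable_lt_set d (T : measurableType d) (R : realType) (f g : T -> R) :
  measurable_fun setT f -> measurable_fun setT g ->
  measurable [set w | f w < g w].
Proof.
move=> mf mg; rewrite -[X in measurable X]setTI.
exact: (measurable_fun_ltr mf mg measurableT (Y := [set true])).
Qed.

Section generated.
Context d (T : measurableType d) (R : realType).

(** Measurability for the sigma-algebra generated by [G] is stated on the
measurable space carried by [g_sigma_algebraType G], so that the closure
properties of measurable functions apply to it unchanged. *)
Definition measurable_wrt (G : set_system T) (U : T -> R) : Prop :=
  @measurable_fun _ _ (g_sigma_algebraType G) R setT U.

Lemma measurable_wrt_preimage (G : set_system T) (U : T -> R) (B : set R) :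
  measurable_wrt G U -> measurable B -> <<s G >> (U @^-1` B).
Proof. by move=> mU mB; rewrite -[_ @^-1` _]setTI; exact: mU. Qed.

Lemma measurable_wrtP (G : set_system T) (U : T -> R) :
  (forall B, measurable B -> <<s G >> (U @^-1` B)) -> measurable_wrt G U.
Proof. by move=> UG _ B mB; rewrite setTI; exact: UG. Qed.

Lemma gen_sub_measurable (G : set_system T) :
  G `<=` measurable -> <<s G >> `<=` measurable.
Proof. by move=> mG; apply: smallest_sub => //; exact: sigma_algebra_measurable. Qed.

Lemma measurable_wrt_fun (G : set_system T) (U : T -> R) :
  G `<=` measurable -> measurable_wrt G U -> measurable_fun setT U.
Proof.
move=> mG mU _ B mB; rewrite setTI; apply: (gen_sub_measurable mG).
exact: measurable_wrt_preimage.
Qed.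

Lemma sigma_gen_preimage (I : Type) (D : set I) (X : I -> T -> R) i (B : set R) :
  D i -> measurable B -> sigma_gen D X (X i @^-1` B).
Proof.
move=> Di mB; apply: sub_sigma_algebra; exists i => //.
by exists B => //; rewrite setTI.
Qed.

Lemma sigma_gen_sub (I : Type) (D : set I) (X : I -> T -> R) (G : set_system T) :
  sigma_algebra setT G ->
  (forall i B, D i -> measurable B -> G (X i @^-1` B)) -> sigma_gen D X `<=` G.
Proof.
move=> sG XG; apply: smallest_sub => // _ [i Di [B mB <-]].
by rewrite setTI; exact: XG.
Qed.

Lemma sigma_algebra_sigma_gen (I : Type) (D : set I) (X : I -> T -> R) :
  sigma_algebra setT (sigma_gen D X).
Proof. exact: smallest_sigma_algebra. Qed.

Lemma sigma_gen_measurable (I : Type) (D : set I) (X : I -> T -> R) :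
  (forall i, D i -> measurable_fun setT (X i)) -> sigma_gen D X `<=` measurable.
Proof.
move=> mX; apply: sigma_gen_sub; first exact: sigma_algebra_measurable.
by move=> i B Di mB; rewrite -[_ @^-1` _]setTI; exact: mX.
Qed.

Lemma measurable_wrt_block (I : Type) (D : set I) (F : I -> set_system T)
    (U : T -> R) i :
  D i -> (forall B, measurable B -> F i (U @^-1` B)) ->
  measurable_wrt (\bigcup_(i in D) F i) U.
Proof.
move=> Di UF; apply: measurable_wrtP => B mB; apply: sub_sigma_algebra.
by exists i => //; exact: UF.
Qed.

End generated.

Section products.
Context d (T : measurableType d) (R : realType) (P : probability T R).

Lemma integralM_wrt (G H : set_system T) (U V : T -> R) :
  G `<=` measurable -> H `<=` measurable ->
  independent P <<s G >> <<s H >> -> measurable_wrt G U -> measurable_wrt H V ->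
  (forall w, 0 <= U w) -> (forall w, 0 <= V w) ->
  (\int[P]_w (U w * V w)%:E = \int[P]_w (U w)%:E * \int[P]_w (V w)%:E)%E.
Proof.
move=> mG mH GH mU mV U0 V0.
apply: independent_integralM => //; [exact: measurable_wrt_fun mU|
  exact: measurable_wrt_fun mV|].
by move=> A B mA mB; apply: GH; exact: measurable_wrt_preimage.
Qed.

End products.

Section exponential_walk.
Context d (T : measurableType d) (R : realType) (P : probability T R).
Variable Y : nat -> int -> {RV P >-> R}.
Hypothesis hY : iid_standard_exponentials Y.

(** Induction on the number of terms: the last summand is independent of the
block of the previous ones. *)
Lemma exponential_sum_laplace (c : R) i j : 0 <= c ->
  (\int[P]_w (expR (- c * \sum_(1 <= l < i.+1) Y l j w))%:E
   = ((1 + c)^-1 ^+ i)%:E)%E.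
Proof.
move=> c0; elim: i => [|i IH].
  under eq_integral do rewrite big_geq// mulr0 expR0.
  by rewrite expr0 integral_cst// mul1e; exact: probability_setT.
case: hY => expY indY.
pose F (ij : nat * int) := sigma_gen [set ij] (fun kl => Y kl.1 kl.2).
pose D1 := [set lj : nat * int | (1 <= lj.1 <= i)%N /\ lj.2 = j].
pose D2 := [set (i.+1, j)].
have mF ij : F ij `<=` measurable by apply: sigma_gen_measurable.
have blk_meas D : \bigcup_(i in D) F i `<=` measurable.
  by move=> A [kl _]; exact: mF.
have FY k l B : measurable B -> F (k, l) (Y k l @^-1` B).
  by move=> mB; apply: (@sigma_gen_preimage _ _ _ _ _ (fun kl => Y kl.1 kl.2) (k, l)).
under eq_integral do rewrite big_nat_recr//= mulrDr expRD.
rewrite (@integralM_wrt _ _ _ _ (\bigcup_(i in D1) F i) (\bigcup_(i in D2) F i))//.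
- rewrite IH (exponential_laplace _ c0) -?EFinM ?exprSr//.
  by move=> A mA; exact: (expY i.+1 j).
- apply: (independent_blocks _ _ indY).
  + by move=> kl _; exact: sigma_algebra_sigma_gen.
  + by move=> kl _; exact: mF.
  + by move=> kl [/andP[]].
  + by move=> _ ->.
  + by apply/seteqP; split=> // -[k l] [[/= /andP[_ ki] _] [ki1 _]]; move: ki; rewrite ki1 ltnn.
- apply: measurableT_comp => //; apply: measurable_funM => //.
  apply: measurable_sum_seq => l; rewrite mem_index_iota => li.
  by apply: (@measurable_wrt_block _ _ _ _ _ _ _ (l, j)) => // B; exact: FY.
- apply: measurableT_comp => //; apply: measurable_funM => //.
  by apply: (@measurable_wrt_block _ _ _ _ _ _ _ (i.+1, j)) => // B; exact: FY.
Qed.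

(** Chernoff's bound with parameter [y^-1].  The right-hand sides sum to exactly
[expR 1 * y] over [i >= 1]. *)
Lemma exponential_sum_tail (y : R) i j : 0 < y ->
  (P [set w | (\sum_(1 <= l < i.+1) Y l j w < y)%R]
   <= (expR 1 * (1 + y^-1)^-1 ^+ i)%:E)%E.
Proof.
move=> y0; have yV0 : 0 <= y^-1 by rewrite invr_ge0 ltW.
have mS : measurable_fun setT (fun w => \sum_(1 <= l < i.+1) Y l j w).
  by apply: measurable_sum_seq.
apply: (@le_trans _ _ (\int[P]_w (expR 1 *
    expR (- y^-1 * \sum_(1 <= l < i.+1) Y l j w))%:E)%E).
  apply: markov_ge1.
  - by exact: measurable_lt_set.
  - apply: measurable_funM => //; apply: measurableT_comp => //.
    exact: measurable_funM.
  - by move=> w; rewrite mulr_ge0 ?expR_ge0.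
  - move=> w /= Sy; rewrite -expRD -[leLHS]expR0 ler_expR mulNr subr_ge0.
    by rewrite mulrC ler_pdivrMr ?mul1r ?ltW.
under eq_integral do rewrite EFinM.
rewrite ge0_integralZl//.
- by rewrite exponential_sum_laplace// EFinM.
- apply/measurable_EFinP; apply: measurableT_comp => //.
  exact: measurable_funM.
Qed.

End exponential_walk.

(** * Brownian motion along a grid *)

Section brownian_walk.
Context d (T : measurableType d) (R : realType) (P : probability T R).
Variable B : R -> {RV P >-> R}.
Hypothesis hB : standard_brownian B.
Variables (p e : R).
Hypotheses (p0 : 0 < p) (eE : e = 1 \/ e = - 1).

(** The sign [e] chooses the half-line, and [m] counts grid steps away from 0,
so that both halves of the path become one-sided walks. *)
Definition bm_step (m : nat) (w : T) : R :=
  B (e * (p * m.+1%:R)) w - B (e * (p * m%:R)) w.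

(** The square root of the exponential martingale exp(B(s) - |s|/2) at
s = e p m, recentred at [B 0]. *)
Definition bm_exp (m : nat) (w : T) : R :=
  expR ((B (e * (p * m%:R)) w - B 0 w) / 2 - p * m%:R / 4).

Let past (m : nat) : set_system T := sigma_gen [set l | (l < m)%N] bm_step.

(** The increments of Brownian motion are indexed by increasing times.  On the
negative half-line the walk meets them in the reverse order and with the
opposite sign, which is what [h] and [s] record. *)
Lemma bm_step_increment (m : nat) : exists t : nat -> R, exists s : R, exists h : nat -> nat,
  [/\ (forall i, t i < t i.+1), (forall i, t i.+1 - t i = p), s = 1 \/ s = -1,
      (forall l, (l <= m)%N -> (h l < m.+1)%N /\
        forall w, bm_step l w = s * (B (t (h l).+1) w - B (t (h l)) w)) &
      (forall l, (l < m)%N -> h l <> h m)].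
Proof.
case: eE => eE1.
  exists (fun i => p * i%:R), 1, id; split=> //.
  - by move=> i; rewrite ltr_pM2l// ltr_nat.
  - by move=> i; rewrite -natr1; ring.
  - by left.
  - by move=> l lm; split=> [|w] //; rewrite /bm_step eE1 !mul1r.
  - by move=> l lm /eqP; rewrite ltn_eqF.
exists (fun i => p * i%:R - p * m.+1%:R), (-1), (fun l => (m - l)%N); split=> //.
- by move=> i; rewrite ltrD2r ltr_pM2l// ltr_nat.
- by move=> i; rewrite -natr1; ring.
- by right.
- move=> l lm; split=> [|w]; first by rewrite ltnS leq_subr.
  rewrite /bm_step eE1 [RHS]mulN1r opprB; congr (B _ w - B _ w).
    by rewrite natrB// -!natr1; ring.
  by rewrite -(natr1 (m - l)) natrB// -natr1; ring.
- by move=> l lm; lia.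
Qed.

Lemma measurable_bm_step l : measurable_fun setT (bm_step l).
Proof. exact: measurable_funB. Qed.

Lemma bm_step_independent m :
  independent P (past m) (sigma_gen [set m] bm_step).
Proof.
have [t [s [h [tS _ s1 hB' hinj]]]] := bm_step_increment m.
pose inc (l : nat) (w : T) : R := B (t l.+1) w - B (t l) w.
pose F (i : nat) := sigma_gen [set i] inc.
have Find : mutually_independent P [set i | (i < m.+1)%N] F.
  by case: hB => _ _ _; apply => i _; exact: tS.
have minc i : measurable_fun setT (inc i) by exact: measurable_funB.
have key (D : set nat) : (forall l, D l -> (l <= m)%N) ->
    sigma_gen D bm_step `<=` <<s \bigcup_(i in h @` D) F i >>.
  move=> Dm; apply: sigma_gen_sub; first exact: smallest_sigma_algebra.
  move=> l A Dl mA; have [hl stepE] := hB' l (Dm _ Dl).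
  apply: sub_sigma_algebra; exists (h l); first by exists l.
  rewrite (_ : _ @^-1` _ = inc (h l) @^-1` ((fun x => s * x) @^-1` A)); last first.
    by apply/seteqP; split=> w /=; rewrite stepE.
  apply: (@sigma_gen_preimage _ _ _ _ _ inc) => //.
  rewrite -[X in measurable X]setTI.
  exact: (@measurable_funM _ _ _ _ (cst s) id).
move=> A C pA pC.
have blocks : independent P
    <<s \bigcup_(i in h @` [set l | (l < m)%N]) F i >>
    <<s \bigcup_(i in h @` [set m]) F i >>.
  apply: (independent_blocks _ _ Find).
  - by move=> i _; exact: sigma_algebra_sigma_gen.
  - by move=> i _; apply: sigma_gen_measurable => ? _; exact: minc.
  - by move=> _ [l /= lm <-]; case: (hB' l (ltnW lm)).
  - by move=> _ [l /= -> <-]; case: (hB' m (leqnn m)).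
  - by apply/seteqP; split=> // i [[l /= lm <-] [k /= -> /esym]]; exact: hinj.
by apply: blocks; [apply: key pA => l /ltnW|apply: key pC => l /= ->].
Qed.

Lemma bm_step_mgf m :
  (\int[P]_w (expR (bm_step m w / 2))%:E = (expR (p / 8))%:E)%E.
Proof.
have [t [s [h [tS tp s1 hB' _]]]] := bm_step_increment m.
have [_ stepE] := hB' m (leqnn m).
under eq_integral => w _ do rewrite stepE mulrAC.
case: hB => _ _ incE _.
rewrite (@normal_mgf _ _ _ _ _ (Num.sqrt p)) ?sqrtr_gt0//.
- rewrite sqr_sqrtr ?ltW// exprMn; congr (expR _)%:E.
  by case: s1 => ->; field.
- exact: measurable_funB.
- by move=> A mA; rewrite -[in RHS](tp (h m)) -incE.
Qed.

Let mG m : past m `<=` measurable.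
Proof. by apply: sigma_gen_measurable => l _; exact: measurable_bm_step. Qed.

Let gensG m : set_system T := \bigcup_(l in [set l | (l < m)%N])
  preimage_set_system setT (bm_step l) measurable.

Let mgensG m : gensG m `<=` measurable.
Proof. by move=> A gA; apply: (mG (m := m)); exact: sub_sigma_algebra. Qed.

Let gens1 m : set_system T := \bigcup_(l in [set m])
  preimage_set_system setT (bm_step l) measurable.

Let mgens1 m : gens1 m `<=` measurable.
Proof.
move=> A [l _ [C mC <-]].
exact: measurable_bm_step.
Qed.

Lemma measurable_wrt_bm_exp m : measurable_wrt (gensG m) (bm_exp m).
Proof.
have BE w : B (e * (p * m%:R)) w - B 0 w = \sum_(l <- index_iota 0 m) bm_step l w.
  elim: m => [|m IH]; first by rewrite !mulr0 subrr big_geq.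
  by rewrite big_nat_recr//= -IH /bm_step; ring.
rewrite /measurable_wrt /bm_exp; apply: measurableT_comp => //.
apply: measurable_funB => //; apply: measurable_funM => //.
under eq_fun do rewrite BE.
apply: measurable_sum_seq => l; rewrite mem_index_iota => /= lm.
apply: measurable_wrtP => A mA.
by apply: (@sigma_gen_preimage _ _ _ _ [set l | (l < m)%N] bm_step l).
Qed.

Lemma measurable_bm_exp m : measurable_fun setT (bm_exp m).
Proof. exact: (measurable_wrt_fun (mgensG (m := m)) (@measurable_wrt_bm_exp m)). Qed.

Lemma bm_exp_ge0 m w : 0 <= bm_exp m w. Proof. exact: expR_ge0. Qed.

(** The factor exp(step/2 - p/4) is independent of the past and has mean
exp(p/8 - p/4). *)
Lemma bm_exp_next m A : past m A ->
  (\int[P]_(w in A) (bm_exp m.+1 w)%:E =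
   (expR (- (p / 8)))%:E * \int[P]_(w in A) (bm_exp m w)%:E)%E.
Proof.
move=> GA; have mA := mG GA.
pose V w := expR (bm_step m w / 2 - p / 4).
have expS w : bm_exp m.+1 w = bm_exp m w * V w.
  by rewrite /bm_exp /V -expRD /bm_step -natr1; congr expR; field.
have indE k : (\int[P]_(w in A) (bm_exp k w)%:E =
    \int[P]_w (bm_exp k w * \1_A w)%:E)%E.
  rewrite integral_mkcond; apply: eq_integral => w _.
  by rewrite epatch_indic EFinM.
rewrite !indE.
under eq_integral do rewrite expS mulrAC.
rewrite (@integralM_wrt _ _ _ _ (gensG m) (gens1 m)
  (fun w => bm_exp m w * \1_A w) V)//.
- rewrite muleC; congr (_ * _)%E.
  under eq_integral do rewrite /V expRD EFinM.
  rewrite ge0_integralZr//.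
  + by rewrite bm_step_mgf -EFinM -expRD; congr (expR _)%:E; field.
  + apply/measurable_EFinP; apply: measurableT_comp => //.
    by apply: measurable_funM => //; exact: measurable_bm_step.
- exact: bm_step_independent.
- apply: measurable_funM; first exact: measurable_wrt_bm_exp.
  exact: measurable_indic.
- apply: measurableT_comp => //; apply: measurable_funB => //.
  apply: measurable_funM => //; apply: measurable_wrtP => C mC.
  exact: (@sigma_gen_preimage _ _ _ _ [set m] bm_step m).
- by move=> w; rewrite mulr_ge0 ?bm_exp_ge0.
- by move=> w; exact: expR_ge0.
Qed.

Lemma bm_exp_mean m : (\int[P]_w (bm_exp m w)%:E = (expR (- (p * m%:R / 8)))%:E)%E.
Proof.
elim: m => [|m IH].
  under eq_integral do rewrite /bm_exp !mulr0 subrr !mul0r subr0 expR0.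
  rewrite mulr0 mul0r oppr0 expR0 integral_cst// mul1e; exact: probability_setT.
rewrite bm_exp_next; last first.
  by have [] := sigma_algebraTI (sigma_algebra_sigma_gen [set l | (l < m)%N] bm_step).
by rewrite IH -EFinM -expRD -natr1; congr (expR _)%:E; field.
Qed.

Lemma bm_exp_maximal (u : R) m0 n : 0 < u ->
  (P [set w | exists2 m, (m0 <= m <= m0 + n)%N & (u < bm_exp m w)%R]
    <= (expR (- (p * m0%:R / 8)) / u)%:E)%E.
Proof.
move=> u0; rewrite EFinM muleC lee_pdivlMl//.
rewrite -bm_exp_mean.
have := @supermartingale_maximal _ _ _ P (fun k => past (m0 + k))
  (fun k => bm_exp (m0 + k)) u; rewrite addn0.
set E := [set w | _] => H.
rewrite (_ : E = [set w | exists2 m, (m <= n)%N & (u < bm_exp (m0 + m) w)%R]).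
  apply: H => //.
  - by move=> k; exact: sigma_algebra_sigma_gen.
  - move=> k; apply: sigma_gen_sub; first exact: sigma_algebra_sigma_gen.
    move=> l C /= lk mC; apply: (@sigma_gen_preimage _ _ _ _ _ bm_step) => //=.
    by rewrite addnS ltnW.
  - move=> k.
    rewrite (_ : [set w | _] = bm_exp (m0 + k) @^-1` `]u, +oo[%classic).
      by apply: measurable_wrt_preimage => //; exact: measurable_wrt_bm_exp.
    by apply/seteqP; split=> w /=; rewrite in_itv/= andbT.
  - by move=> k; exact: measurable_bm_exp.
  - by move=> k w; exact: bm_exp_ge0.
  - move=> k A GA; rewrite addnS bm_exp_next// -[leRHS]mul1e.
    apply: lee_wpmul2r.
      by apply: integral_ge0 => w _; rewrite lee_fin bm_exp_ge0.
    by rewrite lee_fin -expR0 ler_expR oppr_le0 divr_ge0// ltW.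
  - exact: ltW.
apply/seteqP; split=> w [m mn um].
  by exists (m - m0)%N; [lia|rewrite subnKC//; lia].
by exists (m0 + m)%N => //; lia.
Qed.

End brownian_walk.

(** * Measurability of the window and of the maxima *)

Section countable_suprema.
Context d (T : measurableType d) (R : realType).

(** The index set may depend on the point: the supremum exceeds [y] exactly
when some admissible index has a value exceeding [y]. *)
Lemma measurable_ereal_sup (I : countType) (D : I -> set T) (f : I -> T -> \bar R) :
  (forall i, measurable (D i)) -> (forall i, measurable_fun setT (f i)) ->
  measurable_fun setT (fun w => ereal_sup [set f i w | i in [set i | D i w]]).
Proof.
move=> mD mf; apply: (measurability _ (ErealGenOInfty.measurableE R)).
move=> _ [_ [y ->] <-]; rewrite setTI.
rewrite (_ : _ @^-1` _ = \bigcup_i (D i `&` [set w | (y%:E < f i w)%E])).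
  apply: countable_bigcupT_measurable => // i; apply: measurableI => //.
  rewrite -[X in measurable X]setTI.
  exact: emeasurable_fun_o_infty.
apply/seteqP; split=> w /=.
  rewrite in_itv/= andbT => /ereal_sup_gt[_ [i Dw <-] yf].
  by exists i.
move=> [i _ [Dw /= yf]]; rewrite in_itv/= andbT; apply: (lt_le_trans yf).
by apply: ereal_sup_ubound; exists i.
Qed.

Lemma measurable_ereal_inf (I : countType) (D : set I) (f : I -> T -> \bar R) :
  (forall i, measurable_fun setT (f i)) ->
  measurable_fun setT (fun w => ereal_inf [set f i w | i in D]).
Proof.
move=> mf.
have mD i : measurable [set _ : T | D i].
  by case: (pselect (D i)) => Di;
    [rewrite (_ : [set _ | _] = setT)|rewrite (_ : [set _ | _] = set0)];
    rewrite ?predeqE.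
rewrite (_ : (fun w => _) = (fun w => - ereal_sup [set - f i w | i in [set i | D i]])%E).
  apply: measurableT_comp => //.
  apply: (@measurable_ereal_sup _ (fun i => [set _ | D i])) => // i.
  exact: measurableT_comp.
by apply/funext => w; rewrite /ereal_inf image_comp.
Qed.

Lemma measurable_forall (I : countType) (D : set I) (A : I -> set T) :
  (forall i, D i -> measurable (A i)) -> measurable [set w | forall i, D i -> A i w].
Proof.
move=> mA; rewrite (_ : [set w | _] = ~` \bigcup_i (if `[< D i >] then ~` A i else set0)).
  apply: measurableC; apply: countable_bigcupT_measurable => // i.
  by case: asboolP => [/mA /measurableC|].
apply/seteqP; split=> w /=.
  by move=> H [i _]; case: asboolP => // /H.
move=> H i Di; apply: contrapT => nA; apply: H; exists i => //.
by case: asboolP.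
Qed.

Lemma measurable_exists (I : countType) (D : set I) (A : I -> set T) :
  (forall i, D i -> measurable (A i)) -> measurable [set w | exists2 i, D i & A i w].
Proof.
move=> mA; rewrite -[X in measurable X]setCK; apply: measurableC.
rewrite (_ : ~` _ = [set w | forall i, D i -> (~` A i) w]).
  by apply: measurable_forall => i Di; apply: measurableC; exact: mA.
apply/seteqP; split=> w /=; first by move=> H i Di Aw; apply: H; exists i.
by move=> H [i Di Aw]; exact: (H i Di).
Qed.

End countable_suprema.

Section events.
Context d (T : measurableType d) (R : realType) (P : probability T R).
Variables (Y : nat -> int -> {RV P >-> R}) (W : nat -> int -> R -> {RV P >-> R}).
Variables (p : R) (J : set int) (G : set_system T).
Hypothesis p0 : 0 < p.
Hypothesis mY : forall i j, (1 <= i)%N -> J j -> measurable_wrt G (Y i j).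
Hypothesis mW : forall i j t, (1 <= i)%N -> J j -> measurable_wrt G (W i j t).

Lemma XpointE i j w : Xpoint Y i j w = - ln (\sum_(1 <= l < i.+1) Y l j w).
Proof.
rewrite /Xpoint div1r; have [S0|S0] := ltP 0 (\sum_(1 <= l < i.+1) Y l j w).
  by rewrite lnV.
by rewrite !ln0 ?oppr0// invr_le0.
Qed.

Lemma measurable_wrt_Xpoint i j : J j -> measurable_wrt G (Xpoint Y i j).
Proof.
move=> Jj; rewrite /measurable_wrt.
under [X in measurable_fun _ X]funext do rewrite XpointE.
apply: measurableT_comp => //; apply: measurableT_comp => //.
by apply: measurable_sum_seq => l; rewrite mem_index_iota => /andP[l1 _]; apply: mY.
Qed.

Lemma measurable_wrt_drifted i j t : (1 <= i)%N -> J j ->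
  measurable_wrt G (drifted W i j t).
Proof. by move=> i1 Jj; apply: measurable_funB => //; exact: mW. Qed.

Lemma gridP (t : R) : grid p t -> exists m : int, t = m%:~R * p.
Proof. by move=> [m _ <-]; exists m. Qed.

(** A smallest maximizer in the window can only be 0, the one grid point there;
the negative multiples of [p] then fail to be maximizers.  This form uses
countably many values of the path, whence measurability. *)
Lemma in_windowP i j w : in_window W p i j w <->
  argsup_grid W p i j w 0 /\ forall m : int, m < 0 -> ~ argsup_grid W p i j w (m%:~R * p).
Proof.
rewrite /in_window /Tmax; set A := argsup_grid W p i j w.
have hp : 0 < p / 2 by rewrite divr_gt0.
split.
  move=> [lb ub].
  have low t : A t -> - (p / 2) < t.
    move=> At; rewrite -lte_fin (lt_le_trans lb)//.
    by apply: ereal_inf_lbound; exists t.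
  have neg m : m < 0 -> ~ A (m%:~R * p).
    move=> m0 /low; rewrite ltNge => /negP; apply.
    have m1 : m <= -1 by lia.
    have : m%:~R <= (-1)%:~R :> R by rewrite ler_int.
    by rewrite mulrN1z => ?; nra.
  split=> //.
  have /ereal_inf_lt[_ [t At <-]] : (ereal_inf (EFin @` A) < p%:E)%E.
    by apply: le_lt_trans ub _; rewrite lte_fin; lra.
  rewrite lte_fin => tp.
  have [m tE] := gridP At.1.
  have [m0|m0|m0] := ltgtP m 0.
  - by case: (neg _ m0); rewrite -tE.
  - move: tp; rewrite tE gtr_pMl// => m1.
    have : 1 <= m%:~R :> R by rewrite (ler_int R 1 m).
    by rewrite leNgt m1.
  - by move: At; rewrite tE m0 mul0r.
move=> [A0 neg].
have -> : ereal_inf (EFin @` A) = 0%E.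
  apply/eqP; rewrite eq_le; apply/andP; split.
    by apply: ereal_inf_lbound; exists 0.
  apply: le_ereal_inf_tmp => _ [t At <-]; rewrite lee_fin leNgt; apply/negP => t0.
  have [m tE] := gridP At.1.
  apply: (neg m); last by rewrite -tE.
  by move: t0; rewrite tE pmulr_llt0// ltrz0.
by rewrite lte_fin lee_fin oppr_lt0; split=> //; exact: ltW.
Qed.

Lemma measurable_wrt_window i j : (1 <= i)%N -> J j ->
  <<s G >> [set w | in_window W p i j w].
Proof.
move=> i1 Jj.
have marg (m : int) : <<s G >> [set w | argsup_grid W p i j w (m%:~R * p)].
  rewrite (_ : [set w | _] = [set w | forall n : int, setT n ->
      drifted W i j (n%:~R * p) w <= drifted W i j (m%:~R * p) w]).
    apply: (@measurable_forall _ (g_sigma_algebraType G)) => n _.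
    by apply: measurable_le_set; apply: measurable_wrt_drifted.
  apply/seteqP; split=> w /=.
    by move=> [_ H] n _; apply: H; exists n.
  by move=> H; split; [exists m|move=> _ [n _ <-]; exact: H].
rewrite (_ : [set w | _] = [set w | argsup_grid W p i j w (0%:~R * p)] `&`
  [set w | forall m : int, [set m | m < 0] m ->
    (~` [set w | argsup_grid W p i j w (m%:~R * p)]) w]).
  apply: (@measurableI _ (g_sigma_algebraType G)); first exact: marg.
  apply: (@measurable_forall _ (g_sigma_algebraType G)) => m _.
  by apply: (@measurableC _ (g_sigma_algebraType G)); exact: marg.
apply/seteqP; split=> w /=; first by move/in_windowP; rewrite mul0r.
by move=> H; apply/in_windowP; rewrite mul0r in H.
Qed.

Lemma measurable_wrt_Zmax (J' : set int) (I : set nat) (t : R) :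
  J' `<=` J -> (forall i, I i -> (1 <= i)%N) ->
  @measurable_fun _ _ (g_sigma_algebraType G) (\bar R) setT (Zmax Y W p J' I t).
Proof.
move=> J'J I1.
have mconst (Q : Prop) : <<s G >> [set _ : T | Q].
  have [q|q] := pselect Q.
    rewrite (_ : [set _ | _] = setT) ?predeqE//.
    exact: (@measurableT _ (g_sigma_algebraType G)).
  rewrite (_ : [set _ | _] = set0) ?predeqE//.
  exact: (@measurable0 _ (g_sigma_algebraType G)).
rewrite (_ : Zmax Y W p J' I t = (fun w => ereal_sup
    [set (if pselect (J' j) then ereal_sup
      [set (if pselect (I i)
            then (Xpoint Y i j w + drifted W i j (t - p * j%:~R) w)%:E
            else -oo)%E |
         i in [set i | (if pselect (I i)
           then [set w | in_window W p i j w] else set0) w]] else -oo)%E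
     | j in [set j | (fun j => [set _ : T | J' j]) j w]])).
  apply: (@measurable_ereal_sup _ (g_sigma_algebraType G)) => j; first exact: mconst.
  case: pselect => Jj; last exact: measurable_cst.
  apply: (@measurable_ereal_sup _ (g_sigma_algebraType G)) => i.
    case: pselect => Ii; last exact: measurable0.
    by apply: measurable_wrt_window; [exact: I1|exact: J'J].
  case: pselect => Ii; last exact: measurable_cst.
  apply/measurable_EFinP; apply: measurable_funD.
    by apply: measurable_wrt_Xpoint; exact: J'J.
  by apply: measurable_wrt_drifted; [exact: I1|exact: J'J].
apply/funext => w; rewrite /Zmax; congr ereal_sup.
apply: eq_imagel => j Jj; case: pselect => [?|[]//]/=; congr ereal_sup.
apply/seteqP; split=> _ [i /= Ii <-].
  exists i; first by case: pselect => [?|[]]; [exact: Ii.2|exact: Ii.1].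
  by case: pselect => [?|[]] //; exact: Ii.1.
by move: Ii; case: pselect => // Ii Wi; exists i.
Qed.

End events.

(** * Elementary inequalities *)

(** Here (r - 4)^2 / 8 = r^2 / 8 - 1 - (r - 4 + 1); what remains follows from
1 + x <= exp x, (x + 2)^2 >= 8 x at x = r - 4, and sqrt (2 pi) <= 3. *)
Lemma far_bound_le_third_term (R : realType) (r : R) : 4 < r ->
  16 * expR 1 * expR (- (r ^+ 2 / 8)) <=
  8 / Num.sqrt (2 * pi) * (1 + 2 / (r - 4)) * expR (- ((r - 4) ^+ 2 / 8)).
Proof.
move=> r4; have s0 : 0 < r - 4 by rewrite subr_gt0.
have -> : - ((r - 4) ^+ 2 / 8) = 1 + - (r ^+ 2 / 8) + (r - 4 + 1) by field.
rewrite [in leRHS]expRD [expR (1 - _)]expRD.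
set E := expR 1; set Q := expR (- (r ^+ 2 / 8)); set X := expR (r - 4 + 1).
have EQ : 0 < E * Q by rewrite mulr_gt0 ?expR_gt0.
have XL : r - 4 + 2 <= X by apply: le_trans (expR_ge1Dx _); lra.
have pi0 := pi_gt0 R.
have sq0 : 0 < Num.sqrt (2 * pi : R) by rewrite sqrtr_gt0 mulr_gt0.
have sq3 : Num.sqrt (2 * pi : R) <= 3.
  have -> : 3 = Num.sqrt (3 ^+ 2) :> R by rewrite sqrtr_sqr ger0_norm.
  rewrite ler_wsqrtr//; have : pi / 2 < 2 :> R := pihalf_lt2 R; move: (pi : R) => x; lra.
have X8 : 8 <= (1 + 2 / (r - 4)) * X.
  apply: (@le_trans _ _ ((1 + 2 / (r - 4)) * (r - 4 + 2))); last first.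
    by rewrite ler_wpM2l// addr_ge0// divr_ge0// ltW.
  rewrite (_ : 1 + _ = (r - 4 + 2) / (r - 4)); last by field; rewrite gt_eqF.
  by rewrite mulrAC ler_pdivlMr//; have := sqr_ge0 (r - 4 - 2); rewrite expr2; nra.
have S3 : 1 / 3 <= (Num.sqrt (2 * pi : R))^-1 by rewrite div1r lef_pV2 ?posrE.
have : 2 <= (Num.sqrt (2 * pi : R))^-1 * ((1 + 2 / (r - 4)) * X) by nra.
rewrite (_ : 8 / _ * _ * _ =
  8 * (E * Q) * ((Num.sqrt (2 * pi : R))^-1 * ((1 + 2 / (r - 4)) * X))); last by ring.
by move=> h; nra.
Qed.

(** The left-hand side is 1 / (exp x - 1). *)
Lemma geometric_tail_le (R : realType) (x : R) : 0 < x ->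
  expR (- x) / (1 - expR (- x)) <= x^-1.
Proof.
move=> x0; have h : expR (- x) < 1 by rewrite -expR0 ltr_expR oppr_lt0.
rewrite ler_pdivrMr ?subr_gt0// mulrC ler_pdivlMr//.
have := expR_ge1Dx x; have := expR_gt0 (- x).
have : expR (- x) * expR x = 1 by rewrite -expRD addNr expR0.
move=> h1 h2 h3; nra.
Qed.

Lemma dyadic_bracket (R : realType) (x : R) : 0 < x -> x <= 1 ->
  exists n : nat, 2^-1 ^+ n.+1 < x /\ x <= 2^-1 ^+ n.
Proof.
move=> x0 x1.
have ex : exists n : nat, 2^-1 ^+ n.+1 < x.
  have cv : geometric 1 2^-1 @ \oo --> (0 : R).
    by apply: cvg_geometric; rewrite ger0_norm ?invr_ge0// invf_lt1// ltr1n.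
  move/cvgrPdist_lt : cv => /(_ x x0)[n _ /(_ n (leqnn n))].
  rewrite /geometric/= sub0r normrN mul1r ger0_norm ?exprn_ge0 ?invr_ge0// => h.
  exists n; apply: le_lt_trans h; rewrite exprS ler_piMl ?exprn_ge0 ?invr_ge0//.
  by rewrite invf_le1// ler1n.
case: (ex_minnP ex) => -[|n] nx nmin; [exists 0%N|exists n.+1]; split=> //.
by rewrite leNgt; apply/negP => /nmin; rewrite ltnn.
Qed.

(** * Independence of the levels, and almost sure properties *)

Lemma ae_forall_countable d (T : measurableType d) (R : realType)
    (mu : {measure set T -> \bar R}) (I : countType) (Q : I -> T -> Prop) :
  (forall i, {ae mu, forall w, Q i w}) -> {ae mu, forall w, forall i, Q i w}.
Proof.
move=> H; change (mu.-negligible (~` [set w | forall i, Q i w])).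
apply: (@negligibleS _ _ _ _ (\bigcup_n
    (if unpickle n is Some i then ~` [set w | Q i w] else set0))); last first.
  apply: negligible_bigcup => n; case: unpickle => [i|]; first exact: H.
  exact: negligible_set0.
move=> w /= /existsNP[i nQ]; exists (pickle i) => //.
by rewrite pickleK.
Qed.

Section model.
Context d (T : measurableType d) (R : realType) (P : probability T R).
Variables (Y : nat -> int -> {RV P >-> R}) (W : nat -> int -> R -> {RV P >-> R}).
Hypotheses (hY : iid_standard_exponentials Y) (hW : independent_brownians W).
Hypothesis hWY : brownians_independent_of_exponentials Y W.

(** The elementary independent pieces of the model: whole paths on the left,
single exponential variables on the right. *)
Definition coordinate (x : (nat * int) + (nat * int)) : set_system T :=
  match x with
  | inl ij => sigma_gen setT (fun t => W ij.1 ij.2 t)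
  | inr ij => sigma_gen [set ij] (fun kl => Y kl.1 kl.2)
  end.

(** Generators of the sigma-algebra of everything attached to a level in
[J]. *)
Definition levels (J : set int) : set_system T :=
  \bigcup_(x in [set x | match x with inl ij | inr ij => (1 <= ij.1)%N /\ J ij.2 end])
    coordinate x.

Lemma coordinate_measurable x : coordinate x `<=` measurable.
Proof. by case: x => ij; apply: sigma_gen_measurable. Qed.

Lemma levels_measurable J : levels J `<=` measurable.
Proof. by move=> A [x _]; exact: coordinate_measurable. Qed.

Lemma coordinate_independent : mutually_independent P
  [set x | match x with inl ij => pos_index ij | inr ij => pos_index ij end]
  (fun x => match x with
    | inl ij => sigma_gen setT (fun t => W ij.1 ij.2 t)
    | inr ij => sigma_gen [set ij] (fun kl => Y kl.1 kl.2) end).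
Proof.
apply: mutually_independent_sum hWY _ _ hW.2 hY.2.
- exact: sigma_algebra_sigma_gen.
- exact: sigma_algebra_sigma_gen.
- move=> [i j] ij; apply: sigma_gen_sub; first exact: sigma_algebra_sigma_gen.
  move=> t B _ mB.
  exact: (@sigma_gen_preimage _ _ _ _ _
    (fun ijt : nat * int * R => W ijt.1.1 ijt.1.2 ijt.2) (i, j, t)).
- move=> [i j] ij; apply: sigma_gen_sub; first exact: sigma_algebra_sigma_gen.
  move=> _ B -> mB.
  exact: (@sigma_gen_preimage _ _ _ _ _ (fun kl => Y kl.1 kl.2) (i, j)).
Qed.

Lemma levels_independent (J1 J2 : set int) : J1 `&` J2 = set0 ->
  independent P <<s levels J1 >> <<s levels J2 >>.
Proof.
move=> J12; apply: (independent_blocks _ _ coordinate_independent).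
- by case=> ij _; exact: sigma_algebra_sigma_gen.
- by case=> ij _; apply: sigma_gen_measurable.
- by case=> ij [].
- by case=> ij [].
- apply/seteqP; split=> // -[ij|ij] [[_ /= j1] [_ /= j2]].
    by have : (J1 `&` J2) ij.2 by []; rewrite J12.
  by have : (J1 `&` J2) ij.2 by []; rewrite J12.
Qed.

Lemma levels_Y J i j : (1 <= i)%N -> J j -> measurable_wrt (levels J) (Y i j).
Proof.
move=> i1 Jj; apply: (@measurable_wrt_block _ _ _ _ _ _ _ (inr (i, j))) => // B mB.
exact: (@sigma_gen_preimage _ _ _ _ _ (fun kl => Y kl.1 kl.2) (i, j)).
Qed.

Lemma levels_W J i j t : (1 <= i)%N -> J j -> measurable_wrt (levels J) (W i j t).
Proof.
move=> i1 Jj; apply: (@measurable_wrt_block _ _ _ _ _ _ _ (inl (i, j))) => // B mB.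
exact: (@sigma_gen_preimage _ _ _ _ _ (W i j) t).
Qed.

Lemma ae_Y_ge0 : {ae P, forall w, forall ij : nat * int, (1 <= ij.1)%N -> 0 <= Y ij.1 ij.2 w}.
Proof.
apply: ae_forall_countable => -[i j] /=.
have [->|i1] := posnP i; first exact: aeW.
have mlt : measurable [set w | Y i j w < 0] by exact: measurable_lt_set.
change (P.-negligible (~` [set w | true -> 0 <= Y i j w])).
apply: (@negligibleS _ _ _ _ [set w | Y i j w < 0]).
  by move=> w /= H; rewrite ltNge; apply/negP => H'; exact: H.
apply/(negligibleP _ mlt).
have := hY.1 i j i1 `]-oo, 0[%classic (measurable_itv _).
rewrite /exponential_prob integral0_eq.
  by rewrite /distribution /pushforward /= set_itvE; exact.
by move=> x; rewrite /= in_itv/= => x0; rewrite lt0_exponential_pdf.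
Qed.

Lemma ae_W0 : {ae P, forall w, forall ij : nat * int, (1 <= ij.1)%N -> W ij.1 ij.2 0 w = 0}.
Proof.
apply: ae_forall_countable => -[i j] /=.
have [->|i1] := posnP i; first exact: aeW.
case: (hW.1 i j i1) => H _ _ _.
by apply: filterS H => w Ww _.
Qed.

End model.

(** * Probability of a large contribution from a far level *)

Section far.
Context d (T : measurableType d) (R : realType) (P : probability T R).
Variables (Y : nat -> int -> {RV P >-> R}) (W : nat -> int -> R -> {RV P >-> R}).
Variables (p a : R) (N nb : nat).
Let eqR_le (x y : R) : x = y -> x <= y. Proof. by move=> ->. Qed.

Definition near_levels : set int := [set j | - (N%:Z) <= j <= N%:Z].

(** The levels beyond [N], enumerated on each side: positive ones for [true],
negative ones for [false]. *)
Definition far_level (s : bool) (n : nat) : int :=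
  if s then (N + n.+1)%:Z else - (N + n.+1)%:Z.

(** The path of level [j] is observed at the times t - p j, whose sign is
opposite to that of [j]. *)
Definition far_sign (s : bool) : R := if s then -1 else 1.

Definition early_event (i : nat) (j : int) (y : R) : set T :=
  [set w | \sum_(1 <= l < i.+1) Y l j w < y].

Definition high_event (i : nat) (j : int) (e u : R) (m0 n : nat) : set T :=
  [set w | exists2 m, (m0 <= m <= m0 + n)%N & u < bm_exp (W i j) p e m w].

(** The dyadic piece number [k]: the observed times on level number [n] are the
multiples of [p] between [N - nb + n.+1] and [N + nb + n.+1] steps from 0, and
the index of the point is [i.+1]. *)
Definition far_piece (s : bool) (n k i : nat) : set T :=
  early_event i.+1 (far_level s n) (4^-1 ^+ k * a) `&`
  high_event i.+1 (far_level s n) (far_sign s) (2^-1 ^+ k.+1)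
    (N - nb + n.+1) (nb + nb).

Definition far_event : set T :=
  \bigcup_n \bigcup_k \bigcup_i far_piece true n k i `|`
  \bigcup_n \bigcup_k \bigcup_i far_piece false n k i.

Lemma far_level_nnear s n : (~` near_levels) (far_level s n).
Proof. by case: s; rewrite /near_levels /far_level /=; lia. Qed.

Lemma early_event_wrt (G : set_system T) i j y :
  (forall l, (1 <= l)%N -> measurable_wrt G (Y l j)) ->
  <<s G >> (early_event i j y).
Proof.
move=> mY; apply: (@measurable_lt_set _ (g_sigma_algebraType G)) => //.
by apply: measurable_sum_seq => l; rewrite mem_index_iota => /andP[l1 _]; exact: mY.
Qed.

Lemma high_event_wrt (G : set_system T) i j e u m0 n :
  (forall t, measurable_wrt G (W i j t)) -> <<s G >> (high_event i j e u m0 n).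
Proof.
move=> mW; apply: (@measurable_exists _ (g_sigma_algebraType G)) => m _.
apply: (@measurable_lt_set _ (g_sigma_algebraType G)) => //.
apply: measurableT_comp => //; apply: measurable_funB => //.
by apply: measurable_funM => //; apply: measurable_funB; exact: mW.
Qed.

Lemma far_piece_levels s n k i : <<s levels Y W (~` near_levels) >> (far_piece s n k i).
Proof.
apply: (@measurableI _ (g_sigma_algebraType _)).
  apply: early_event_wrt => l l1; apply: levels_Y => //; exact: far_level_nnear.
apply: high_event_wrt => t; apply: levels_W => //; exact: far_level_nnear.
Qed.

Lemma far_event_levels : <<s levels Y W (~` near_levels) >> far_event.
Proof.
by apply: (@measurableU _ (g_sigma_algebraType _));
  apply: (@bigcupT_measurable _ (g_sigma_algebraType _)) => n;
  apply: (@bigcupT_measurable _ (g_sigma_algebraType _)) => k;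
  apply: (@bigcupT_measurable _ (g_sigma_algebraType _)) => i;
  exact: far_piece_levels.
Qed.

Lemma measurable_far_piece s n k i : measurable (far_piece s n k i).
Proof.
by apply: (gen_sub_measurable (@levels_measurable _ _ _ _ Y W _)); exact: far_piece_levels.
Qed.

Hypotheses (hY : iid_standard_exponentials Y) (hW : independent_brownians W).
Hypothesis hWY : brownians_independent_of_exponentials Y W.

Lemma early_high_independent i j y e u m0 n : (1 <= i)%N ->
  P (early_event i j y `&` high_event i j e u m0 n) =
  (P (early_event i j y) * P (high_event i j e u m0 n))%E.
Proof.
move=> i1; rewrite setIC muleC; apply: hWY.
  apply: high_event_wrt => t; apply: measurable_wrtP => B mB.
  exact: (@sigma_gen_preimage _ _ _ _ [set ijt | pos_index ijt.1]
    (fun ijt : nat * int * R => W ijt.1.1 ijt.1.2 ijt.2) (i, j, t)).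
apply: early_event_wrt => l l1; apply: measurable_wrtP => B mB.
exact: (@sigma_gen_preimage _ _ _ _ pos_index (fun ij => Y ij.1 ij.2) (l, j)).
Qed.

Lemma far_sign1 s : far_sign s = 1 \/ far_sign s = -1.
Proof. by case: s; [right|left]. Qed.

Hypotheses (p0 : 0 < p) (a0 : 0 < a).

Lemma far_piece_prob s n k i :
  (P (far_piece s n k i) <=
   (expR 1 * (1 + (4^-1 ^+ k * a)^-1)^-1 ^+ i.+1 *
     (expR (- (p * (N - nb + n.+1)%:R / 8)) / 2^-1 ^+ k.+1))%:E)%E.
Proof.
rewrite /far_piece early_high_independent// EFinM; apply: lee_pmul => //.
- by apply: exponential_sum_tail => //; rewrite mulr_gt0 ?exprn_gt0 ?invr_gt0.
- apply: bm_exp_maximal => //.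
  + by case: hW => + _; exact.
  + exact: far_sign1.
Qed.

(** Sum over the index [i] at a fixed dyadic size, then over the dyadic sizes
[k], then over the levels [n]; each sum is geometric. *)
Lemma far_side_prob s :
  (P (\bigcup_n \bigcup_k \bigcup_i far_piece s n k i) <=
   (32 * a / p * (expR 1 * expR (- (p * (N - nb)%:R / 8))))%:E)%E.
Proof.
have meas1 n k : measurable (\bigcup_i far_piece s n k i).
  by apply: bigcupT_measurable => i; exact: measurable_far_piece.
have meas2 n : measurable (\bigcup_k \bigcup_i far_piece s n k i).
  by apply: bigcupT_measurable => i; exact: meas1.
pose K n := expR (- (p * (N - nb + n.+1)%:R / 8)).
have K0 n : 0 < K n by exact: expR_gt0.
have step1 n k : (P (\bigcup_i far_piece s n k i) <=
    (2 * a * (expR 1 * K n) * 2^-1 ^+ k)%:E)%E.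
  set y := 4^-1 ^+ k * a.
  have y0 : 0 < y by rewrite mulr_gt0 ?exprn_gt0 ?invr_gt0.
  set q := (1 + y^-1)^-1.
  have yV0 : 0 < y^-1 by rewrite invr_gt0.
  have q0 : 0 < q by rewrite invr_gt0 addr_gt0.
  have q1 : q < 1 by rewrite invf_lt1 ?addr_gt0// ltrDl.
  have e0 : 0 < 2^-1 ^+ k.+1 :> R by rewrite exprn_gt0 ?invr_gt0.
  apply: (@le_trans _ _ ((expR 1 * q * (K n / 2^-1 ^+ k.+1)) / (1 - q))%:E).
    apply: measure_bigcup_geometric => //; first exact: measurable_far_piece.
    - by apply/ltW; apply: mulr_gt0; [apply: mulr_gt0 => //; exact: expR_gt0|exact: divr_gt0].
    - exact: ltW.
    - move=> i; apply: le_trans (far_piece_prob s n k i) _.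
      by rewrite lee_fin exprS; apply: eqR_le; rewrite -/y -/q /K; ring.
  rewrite lee_fin; apply: eqR_le.
  (* the geometric series of ratio q = y / (1 + y), started at i = 1 *)
  have qy : q / (1 - q) = y.
    have qM : 1 - q = q * y^-1.
      by rewrite -[1](@mulVf _ (1 + y^-1)) ?gt_eqF ?addr_gt0// -/q mulrDr mulr1 addrAC subrr add0r.
    by rewrite qM invfM mulrA divff ?mul1r ?gt_eqF// invrK.
  transitivity (expR 1 * K n * (q / (1 - q)) / 2^-1 ^+ k.+1); first by ring.
  rewrite qy /y exprS (_ : 4^-1 = 2^-1 * 2^-1 :> R); last by field.
  by rewrite exprMn; field; rewrite expf_neq0// invr_eq0.
have step2 n : (P (\bigcup_k \bigcup_i far_piece s n k i) <=
    (4 * a * expR 1 * expR (- (p * (N - nb)%:R / 8)) *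
      expR (- (p / 8)) * expR (- (p / 8)) ^+ n)%:E)%E.
  apply: (@le_trans _ _ ((2 * a * (expR 1 * K n)) / (1 - 2^-1))%:E).
    apply: measure_bigcup_geometric => //.
    - by apply/ltW; rewrite !mulr_gt0 ?expR_gt0.
    - by rewrite invf_lt1// ltr1n.
    - exact: step1.
  rewrite lee_fin; apply: eqR_le.
  have -> : K n = expR (- (p * (N - nb)%:R / 8)) * expR (- (p / 8)) * expR (- (p / 8)) ^+ n.
    by rewrite -!expRM_natl -!expRD /K natrD -natr1; congr expR; field.
  by field.
apply: (@le_trans _ _ (4 * a * expR 1 * expR (- (p * (N - nb)%:R / 8)) *
   expR (- (p / 8)) / (1 - expR (- (p / 8))))%:E).
  apply: measure_bigcup_geometric => //.
  - by apply/ltW; rewrite !mulr_gt0 ?expR_gt0.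

  - by rewrite -expR0 ltr_expR oppr_lt0 divr_gt0.
rewrite lee_fin -mulrA.
have h := @geometric_tail_le _ (p / 8) (divr_gt0 p0 (ltr0n _ 8)).
apply: (@le_trans _ _ (4 * a * expR 1 * expR (- (p * (N - nb)%:R / 8)) * (p / 8)^-1)).
  by rewrite ler_wpM2l//; apply/ltW; rewrite !mulr_gt0 ?expR_gt0.
by apply: eqR_le; field; rewrite gt_eqF.
Qed.

Lemma far_event_prob :
  (P far_event <= (64 * a / p * (expR 1 * expR (- (p * (N - nb)%:R / 8))))%:E)%E.
Proof.
have meas s : measurable (\bigcup_n \bigcup_k \bigcup_i far_piece s n k i).
  apply: bigcupT_measurable => n; apply: bigcupT_measurable => k.
  by apply: bigcupT_measurable => i; exact: measurable_far_piece.
apply: le_trans (measureU2 _ _ _) _ => //.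
rewrite (_ : 64 * a / p * _ = 32 * a / p * (expR 1 * expR (- (p * (N - nb)%:R / 8)))
  + 32 * a / p * (expR 1 * expR (- (p * (N - nb)%:R / 8)))); last by ring.
by rewrite EFinD; apply: leeD; exact: far_side_prob.
Qed.

End far.

(** * Reduction to the far levels *)

Section conclusion.
Context d (T : measurableType d) (R : realType) (P : probability T R).
Variables (Y : nat -> int -> {RV P >-> R}) (W : nat -> int -> R -> {RV P >-> R}).
Variables (p b c : R) (k N nb : nat).
Hypotheses (p0 : 0 < p) (c0 : c < 0).
Hypotheses (bE : b = nb%:R * p) (nbN : (nb <= N)%N).

Definition differ_event : set T :=
  [set w | exists2 t, (`[- b, b] `&` grid p) t &
     Z3 Y W (- N%:Z) N%:Z k p t w <> Z3tilde Y W p t w].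

Definition near_event : set T :=
  [set w | (Xk Y (- N%:Z) N%:Z k w <= c%:E)%E /\
           (c%:E < Ck Y W (- N%:Z) N%:Z b k p w)%E].

Lemma measurable_differ_event : measurable differ_event.
Proof.
rewrite (_ : differ_event = [set w | exists2 m : int, `[- b, b]%classic (m%:~R * p) &
   [set w | Z3 Y W (- N%:Z) N%:Z k p (m%:~R * p) w != Z3tilde Y W p (m%:~R * p) w] w]).
  apply: measurable_exists => m _; rewrite -[X in measurable X]setTI.
  have lev : <<s levels Y W setT >> `<=` measurable.
    exact: (gen_sub_measurable (@levels_measurable _ _ _ _ Y W _)).
  apply: lev.
  apply: (@measurable_neqe _ (g_sigma_algebraType (levels Y W setT))) => //;
    apply: (@measurable_wrt_Zmax _ _ _ _ _ _ _ setT) => //.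
  - by move=> i j i1 _; exact: levels_Y.
  - by move=> i j t i1 _; exact: levels_W.
  - by move=> i /andP[].
  - by move=> i j i1 _; exact: levels_Y.
  - by move=> i j t i1 _; exact: levels_W.
apply/seteqP; split=> w.
  move=> [t [tb /gridP[m tE]]]; rewrite tE in tb * => /eqP neq.
  by exists m.
by move=> [m mb /= /eqP neq]; exists (m%:~R * p) => //; split=> //; exists m.
Qed.

Lemma near_event_levels : <<s levels Y W (near_levels N) >> near_event.
Proof.
set G := levels _ _ _.
have mX : @measurable_fun _ _ (g_sigma_algebraType G) (\bar R) setT (Xk Y (- N%:Z) N%:Z k).
  rewrite (_ : Xk _ _ _ _ = fun w => ereal_sup
    [set (if pselect (near_levels N j) then (Xpoint Y k j w)%:E else -oo)%E |
       j in [set j | (fun j => [set _ : T | near_levels N j]) j w]]).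
    apply: (@measurable_ereal_sup _ (g_sigma_algebraType G)) => j.
      have [q|q] := pselect (near_levels N j).
        rewrite (_ : [set _ | _] = setT) ?predeqE//.
        exact: (@measurableT _ (g_sigma_algebraType G)).
      rewrite (_ : [set _ | _] = set0) ?predeqE//.
      exact: (@measurable0 _ (g_sigma_algebraType G)).
    case: pselect => Jj; last exact: measurable_cst.
    apply/measurable_EFinP.
    apply: (@measurable_wrt_Xpoint _ _ _ _ _ (near_levels N)) => // i l i1 Jl.
    exact: levels_Y.
  apply/funext => w; congr ereal_sup; apply: eq_imagel => j Jj.
  by case: pselect.
have mC : @measurable_fun _ _ (g_sigma_algebraType G) (\bar R) setT (Ck Y W (- N%:Z) N%:Z b k p).
  rewrite (_ : Ck _ _ _ _ _ _ _ = fun w => ereal_inf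
    [set Z3 Y W (- N%:Z) N%:Z k p (m%:~R * p) w |
       m in [set m : int | `[- b, b]%classic (m%:~R * p)]]).
    apply: (@measurable_ereal_inf _ (g_sigma_algebraType G)) => m.
    apply: (@measurable_wrt_Zmax _ _ _ _ _ _ _ (near_levels N)) => //.
    - by move=> i j i1 Jj; exact: levels_Y.
    - by move=> i j t i1 Jj; exact: levels_W.
    - by move=> i /andP[].
  apply/funext => w; congr ereal_inf; apply/seteqP; split=> z.
    by move=> [t [tb /gridP[m tE]] <-]; rewrite tE in tb *; exists m.
  by move=> [m mb <-]; exists (m%:~R * p) => //; split=> //; exists m.
apply: (@measurableI _ (g_sigma_algebraType G) [set w | (Xk Y (- N%:Z) N%:Z k w <= c%:E)%E]
  [set w | (c%:E < Ck Y W (- N%:Z) N%:Z b k p w)%E]).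
  rewrite -[X in measurable X]setTI.
  exact: (@emeasurable_fun_infty_c _ (g_sigma_algebraType G)).
rewrite -[X in measurable X]setTI.
exact: (@emeasurable_fun_o_infty _ (g_sigma_algebraType G)).
Qed.

(** With [D] the drifted value, exp(D/2) lies in a dyadic interval
(2^(-q-1), 2^(-q)]; then [c < - ln S + D] gives S < exp(D - c), which is at most
4^(-q) exp(-c). *)
Lemma far_point_in_piece (j : int) i (t : R) w :
  ~ near_levels N j -> (1 <= i)%N -> `[- b, b]%classic t -> grid p t ->
  W i j 0 w = 0 -> drifted W i j (t - p * j%:~R) w <= 0 ->
  c < Xpoint Y i j w + drifted W i j (t - p * j%:~R) w ->
  exists s n l, far_piece Y W p (expR (- c)) N nb s n l i.-1 w.
Proof.
move=> jN i1 tb /gridP[m tE] W0; set D := drifted _ _ _ _ _ => D0 cXD.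
have [mlo mhi] : - nb%:Z <= m /\ m <= nb%:Z.
  move: tb; rewrite /= in_itv/= tE bE => /andP[lo hi].
  split; last by rewrite -(ler_int R) -(ler_pM2r p0).
  by rewrite -(ler_int R) -(ler_pM2r p0) rmorphN mulNr.
have tj : t - p * j%:~R = (m - j)%:~R * p by rewrite tE rmorphB/=; ring.
have [s [n [l [jE lE llo lhi]]]] : exists s n l,
  [/\ j = far_level N s n, (m - j)%:~R = far_sign R s * l%:R,
    (N - nb + n.+1 <= l)%N & (l <= N - nb + n.+1 + (nb + nb))%N].
  have [jpos|jneg] := ltP 0 j.
    exists true, (`|j| - N).-1%N, `|j - m|%N; rewrite /far_level /far_sign.
    have jN' : N%:Z < j by move: jN; rewrite /near_levels /=; lia.
    split; [lia| |lia|lia].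
    by rewrite mulN1r -[_%:R]/((`|j - m|%N)%:~R) -rmorphN/=; congr (_%:~R); lia.
  exists false, (`|j| - N).-1%N, `|m - j|%N; rewrite /far_level /far_sign.
  have jN' : j < - N%:Z by move: jN; rewrite /near_levels /=; lia.
  split; [lia| |lia|lia].
  by rewrite mul1r -[_%:R]/((`|m - j|%N)%:~R); congr (_%:~R); lia.
have x0 : 0 < expR (D / 2) := expR_gt0 _.
have x1 : expR (D / 2) <= 1 by rewrite -expR0 ler_expR pmulr_lle0 ?invr_gt0.
have [q [qx xq]] := dyadic_bracket x0 x1.
exists s, n, q; case: i i1 @D D0 cXD W0 x0 x1 qx xq => // i _ D D0 cXD W0 x0 x1 qx xq /=.
rewrite /far_piece -jE; split.
- rewrite /early_event /=; set S := \sum_(_ <= _ < _) _.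
  (* the case S <= 0, where [ln S] has its default value, is immediate *)
  have [S0|S0] := ltP 0 S; last first.
    by apply: le_lt_trans S0 _; rewrite mulr_gt0 ?expR_gt0 ?exprn_gt0 ?invr_gt0.
  apply: (@lt_le_trans _ _ (expR (D - c))).
    rewrite -[S]lnK ?posrE// ltr_expR.
    by move: cXD; rewrite XpointE -/S; lra.
  rewrite expRD ler_wpM2r ?expR_ge0//.
  rewrite (_ : D = D / 2 + D / 2); last by field.
  rewrite expRD (_ : 4^-1 = 2^-1 * 2^-1 :> R); last by field.
  by rewrite exprMn ler_pM// expR_ge0.
- exists l; first by rewrite llo.
  apply: lt_le_trans qx _; rewrite /bm_exp ler_expR W0 subr0 /D /drifted tj lE.
  have -> : far_sign R s * l%:R * p = far_sign R s * (p * l%:R) by ring.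
  have -> : `|far_sign R s * (p * l%:R)| = p * l%:R.
    rewrite normrM (_ : `|far_sign R s| = 1) ?mul1r; last first.
      by case: s {jE lE}; rewrite /far_sign ?normrN normr1.
    by rewrite ger0_norm// mulr_ge0// ltW.
  lra.
Qed.

(** The indices [i <= k] on near levels are already part of [Z3], and the
indices [i > k] there contribute at most [Xpoint k j], because the value in the
window is nonpositive. *)
Lemma differ_sub_far w :
  (forall i j, (1 <= i)%N -> 0 <= Y i j w) ->
  (forall i j, (1 <= i)%N -> W i j 0 w = 0) ->
  differ_event w -> near_event w -> far_event Y W p (expR (- c)) N nb w.
Proof.
move=> Y0 W0 [t [tb tg] neq] [Xc cC].
have cZ : (c%:E < Z3 Y W (- N%:Z) N%:Z k p t w)%E.
  by apply: lt_le_trans cC _; apply: ereal_inf_lbound; exists t.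
have : (Z3 Y W (- N%:Z) N%:Z k p t w < Z3tilde Y W p t w)%E.
  rewrite lt_neqAle; apply/andP; split; first exact/eqP.
  apply: ge_ereal_sup => _ [j Jj <-].
  apply: (@le_trans _ _ (ereal_sup [set (Xpoint Y i j w + drifted W i j (t - p * j%:~R) w)%:E |
         i in [set i | [set i | (1 <= i)%N] i /\ in_window W p i j w]])).
    apply: ereal_sup_le => _ [i [/= /andP[i1 _] iw] <-].
    by exists i.
  by apply: ereal_sup_ubound; exists j.
move=> /ereal_sup_gt[_ [j _ <-]] /ereal_sup_gt[_ [i [/= i1 iw] <-]] ZX.
have cX : c < Xpoint Y i j w + drifted W i j (t - p * j%:~R) w.
  by rewrite -lte_fin (lt_trans cZ).
have D0 : drifted W i j (t - p * j%:~R) w <= 0.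
  have [[_ + ] _] := (in_windowP W p0 i j w).1 iw.
  rewrite {2}/drifted W0// normr0 mul0r subr0; apply.
  have [m ->] := gridP tg; exists (m - j) => //.
  by rewrite rmorphB/=; ring.
have jN : ~ near_levels N j.
  move=> Jj; have [ik|ki] := leqP i k.
    move: ZX; rewrite ltNge => /negP; apply.
    apply: (@le_trans _ _ (ereal_sup [set (Xpoint Y i j w + drifted W i j (t - p * j%:~R) w)%:E |
         i in [set i | [set i | (1 <= i <= k)%N] i /\ in_window W p i j w]])).
      by apply: ereal_sup_ubound; exists i => //; split=> //=; rewrite i1.
    by apply: ereal_sup_ubound; exists j.
  have Xkc : Xpoint Y k j w <= c.
    rewrite -lee_fin; apply: le_trans Xc.
    by apply: ereal_sup_ubound; exists j.
  suff : Xpoint Y i j w <= Xpoint Y k j w by lra.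
  move: Xkc; rewrite !XpointE.
  set Sk := \sum_(1 <= l < k.+1) Y l j w.
  (* [ln] vanishes on nonpositive reals, so [- ln Sk <= c < 0] forces [0 < Sk] *)
  move=> Xkc; have Sk0 : 0 < Sk.
    by rewrite ltNge; apply/negP => /ln0 Sk0; move: Xkc; rewrite Sk0 oppr0 leNgt c0.
  have SkSi : Sk <= \sum_(1 <= l < i.+1) Y l j w.
    rewrite (@big_cat_nat _ _ _ k.+1 1 i.+1)//=; last by rewrite ltnS ltnW.
    rewrite lerDl big_nat sumr_ge0// => l /andP[kl _]; apply: Y0.
    by apply: leq_trans kl.
  by rewrite lerN2 ler_ln ?posrE// (lt_le_trans Sk0).
have [s [n [l piece]]] := far_point_in_piece jN i1 tb tg (W0 i j i1) D0 cX.
by case: s piece => piece; [left|right]; exists n => //; exists l => //; exists i.-1.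
Qed.

End conclusion.

Lemma cond_prob_le d (T : measurableType d) (R : realType) (P : probability T R)
    (A B : set T) (C : R) : measurable B -> 0 <= C ->
  (P (A `&` B) <= P B * C%:E)%E -> cond_prob P A B <= C.
Proof.
move=> mB C0; rewrite /cond_prob; have Bfin := fin_num_measure P B mB.
rewrite -[in X in (_ <= X)%E](fineK Bfin) => AB.
have B0 : 0 <= fine (P B) by rewrite fine_ge0.
have [BE|Bn0] := eqVneq (fine (P B)) 0; first by rewrite BE invr0 mulr0.
rewrite ler_pdivrMr ?lt_neqAle 1?eq_sym ?Bn0// mulrC -lee_fin.
apply: le_trans AB; have : (0 <= P (A `&` B))%E := measure_ge0 P _.
by case: (P (A `&` B)) => //= _; rewrite leey.
Qed.

Theorem proposition3p12 (d : measure_display) (T : measurableType d)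
    (R : realType) (P : probability T R)
    (Y : nat -> int -> {RV P >-> R}) (W : nat -> int -> R -> {RV P >-> R})
    (hY : iid_standard_exponentials Y)
    (hW : independent_brownians W)
    (hWY : brownians_independent_of_exponentials Y W)
    (p b c : R) (k : nat) (jmin jmax : int)
    (hp : 0 < p)
    (hb : exists2 m : int, 0 < m & b = m%:~R * p)
    (hk : (1 <= k)%N)
    (hj : jmin = - jmax) (hjmin : jmin < 0)
    (hbj : b + 16 < p * jmax%:~R)
    (hc : c < 0) :
  let r := Num.sqrt (p * jmax%:~R - b) in
  cond_prob P
    [set w | exists2 t, (`[- b, b] `&` grid p) t &
       Z3 Y W jmin jmax k p t w <> Z3tilde Y W p t w]
    [set w | (Xk Y jmin jmax k w <= c%:E)%E /\
       (c%:E < Ck Y W jmin jmax b k p w)%E]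
  <= 4 * expR (- c) / p *
     (expR (- r)
      + 100 / 9 * Num.sqrt (b ^+ 3 / pi)
          * expR (- ((r - ln r) ^+ 2 / (4 * b)))
      + 8 / Num.sqrt (2 * pi) * (1 + 2 / (r - 4))
          * expR (- ((r - 4) ^+ 2 / 8))).
Proof.
case: hb => mb mb0 bE; cbv zeta.
(* in natural numbers: the near levels are [-N, N] and [b] is [nb] grid steps *)
have [N NE] : exists N : nat, jmax = N%:Z by exists `|jmax|%N; lia.
have [nb nbE] : exists nb : nat, mb = nb%:Z by exists `|mb|%N; lia.
rewrite {}hj {}NE {}nbE in hjmin hbj bE *.
rewrite -[_%:~R]/(nb%:R) in bE; rewrite -[_%:~R]/(N%:R) in hbj *.
set r := Num.sqrt (p * N%:R - b).
have nbN : (nb <= N)%N.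
  by rewrite -(ler_nat R) -(ler_pM2l hp) [p * nb%:R]mulrC -bE; lra.
have rE : r ^+ 2 = p * (N - nb)%:R.
  by rewrite /r sqr_sqrtr; [rewrite natrB// bE; ring|lra].
have r4 : 4 < r.
  have -> : 4 = Num.sqrt (4 ^+ 2) :> R by rewrite sqrtr_sqr ger0_norm.
  by rewrite ltr_sqrt; lra.
set A := [set w | exists2 t, _ & _]; set B := [set w | _ /\ _].
pose C := 64 * expR (- c) / p * (expR 1 * expR (- (p * (N - nb)%:R / 8))).
have mlev J : <<s levels Y W J >> `<=` measurable.
  exact: (gen_sub_measurable (@levels_measurable _ _ _ _ Y W _)).
have mA : measurable A by exact: measurable_differ_event.
have levB : <<s levels Y W (near_levels N) >> B by exact: near_event_levels.
have mB : measurable B by exact: mlev levB.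
pose E := far_event Y W p (expR (- c)) N nb.
have levE : <<s levels Y W (~` near_levels N) >> E by exact: far_event_levels.
have mE : measurable E by exact: mlev levE.
have BE : P (B `&` E) = (P B * P E)%E.
  by apply: (levels_independent hY hW hWY _ levB levE); rewrite setICr.
(* outside the null set [Z], the exponentials are nonnegative and W(0) = 0 *)
have [Z [mZ Z0 nullZ]] : P.-negligible (~` [set w |
    (forall ij : nat * int, (1 <= ij.1)%N -> 0 <= Y ij.1 ij.2 w) /\
    (forall ij : nat * int, (1 <= ij.1)%N -> W ij.1 ij.2 0 w = 0)]).
  exact: filterI (ae_Y_ge0 hY) (ae_W0 hW).
have sub : A `&` B `<=` (B `&` E) `|` Z.
  move=> w [Aw Bw]; have [wZ|wZ] := pselect (Z w); [by right|left].
  have [Y0 W0] : (forall ij : nat * int, (1 <= ij.1)%N -> 0 <= Y ij.1 ij.2 w) /\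
      (forall ij : nat * int, (1 <= ij.1)%N -> W ij.1 ij.2 0 w = 0).
    by apply: contrapT => /nullZ.
  split=> //; apply: (@differ_sub_far _ _ _ _ _ _ p b c k) => //.
    by move=> i j; exact: (Y0 (i, j)).
  by move=> i j; exact: (W0 (i, j)).
have AB : (P (A `&` B) <= P B * C%:E)%E.
  apply: (@le_trans _ _ (P (B `&` E `|` Z))).
    by apply: le_measure => //; rewrite inE; [exact: measurableI|
      apply: measurableU => //; exact: measurableI].
  apply: (@le_trans _ _ (P (B `&` E) + P Z)%E).
    by apply: measureU2 => //; exact: measurableI.
  rewrite BE (_ : P Z = 0%E) ?adde0//; apply: lee_wpmul2l => //.
  by apply: far_event_prob => //; exact: expR_gt0.
have C0 : 0 <= C by apply/ltW; rewrite !mulr_gt0 ?expR_gt0 ?invr_gt0.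
apply: le_trans (cond_prob_le mB C0 AB) _.
have -> : C = 4 * expR (- c) / p * (16 * expR 1 * expR (- (r ^+ 2 / 8))).
  by rewrite rE /C; ring.
apply: ler_wpM2l; first by apply/ltW; rewrite !mulr_gt0 ?expR_gt0 ?invr_gt0.
apply: le_trans (far_bound_le_third_term r4) _; rewrite lerDr addr_ge0 ?expR_ge0//.
Qed.
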